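(* Let $T\ge1$ and let $x_T$ be the final iterate of the Non-monotone Stochastic Continuous Greedy (NMSCG) method (defined in the context) with averaging parameter $\rho_t=4/(t+8)^{2/3}$ for the problem $\max_{x\in C}F(x)$, where $F:\mathcal{X}\to\mathbb{R}_+$ is DR-submodular and not necessarily monotone. Suppose that: (1) $\|x\|\le D$ for all $x\in C$; (2) the stochastic gradients are unbiased, $\mathbb{E}_{z\sim P}[\nabla\tilde F(x,z)]=\nabla F(x)$, and $\mathbb{E}_{z\sim P}\big[\|\nabla\tilde F(x,z)-\nabla F(x)\|^2\big]\le\sigma^2$ for all $x\in C$; (3) $\nabla F$ is $L$-Lipschitz continuous on $\mathcal{X}$, i.e. $\|\nabla F(x)-\nabla F(y)\|\le L\|x-y\|$ for all $x,y\in\mathcal X$; (4) the convex set $C$ is down-closed. Then $$\mathbb{E}[F(x_T)]\ge e^{-1}F(x^* )-\frac{15DQ^{1/2}}{T^{1/3}}-\frac{LD^2}{2T},$$ where $x^*\in\arg\max_{x\in C}F(x)$ and $Q:=\max\{4\|\nabla F(x_0)-d_0\|^2,\ 16\sigma^2+2L^2D^2\}$.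
   Context: Setting: $\mathcal{X}=\prod_{i=1}^n[\underline{u}_i,\bar u_i]\subset\mathbb{R}_+^n$ is a bounded box, $\bar u=(\bar u_1,\dots,\bar u_n)$, and $C\subseteq\mathcal{X}$ is a compact convex set with $0\in C$. $z$ is a random variable with distribution $P$, $\tilde F(x,z)$ is a stochastic function, and $F(x)=\mathbb{E}_{z\sim P}[\tilde F(x,z)]$ is differentiable. $\|\cdot\|$ is the Euclidean norm; vector inequalities are componentwise. $C$ is down-closed if $x\in C$ and $0\le y\le x$ imply $y\in C$. A differentiable $F$ is DR-submodular if it is submodular, i.e. $F(x)+F(y)\ge F(x\vee y)+F(x\wedge y)$ for all $x,y\in\mathcal X$ ($\vee,\wedge$ the componentwise max and min), and its gradient is antitone: $x\le y\Rightarrow\nabla F(x)\ge\nabla F(y)$ for $x,y\in\mathcal{X}$. NMSCG method with $T$ iterations: $x_0=d_0=0$; with i.i.d. samples $z_1,z_2,\dots\sim P$, $$d_t=(1-\rho_t)d_{t-1}+\rho_t\nabla\tilde F(x_t,z_t)\quad(t\ge1),$$ $$v_t\in\arg\max\{d_t^Tv:\ v\in C,\ v\le\bar u-x_t\},\qquad x_{t+1}=x_t+\frac1Tv_t\quad(t=0,1,\dots,T-1).$$ (Since $d_0=0$, $v_0$ is an arbitrary fixed point of $C$; maximizers are chosen measurably.) The expectation is over all the samples. *)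

(* Defs.v *)
From HB Require Import structures.
From mathcomp Require Export all_boot all_order all_algebra.
From mathcomp Require Export all_classical all_reals all_analysis.
Export Order.TTheory GRing.Theory Num.Theory.
Export numFieldNormedType.Exports.

Set Implicit Arguments.
Unset Strict Implicit.
Unset Printing Implicit Defensive.

Local Open Scope classical_set_scope.
Local Open Scope ring_scope.

Section Vectors.
Context {R : realType} {n : nat}.
Implicit Types (x y g : 'rV[R]_n) (A : set 'rV[R]_n).

Definition dotv x y : R := \sum_(i < n) x 0 i * y 0 i.

(* The library norm on matrices is the sup norm, hence this definition; both
   norms induce the same topology. *)
Definition enorm x : R := Num.sqrt (\sum_(i < n) x 0 i ^+ 2).

Definition vle x y : Prop := forall i, x 0 i <= y 0 i.

Definition vmax x y : 'rV[R]_n := map2_mx Num.max x y.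
Definition vmin x y : 'rV[R]_n := map2_mx Num.min x y.

Definition box (l u : 'rV[R]_n) : set 'rV[R]_n :=
  [set x | vle l x /\ vle x u].

Definition down_closed A : Prop :=
  forall x y, A x -> vle 0 y -> vle y x -> A y.

Definition argmax (f : 'rV[R]_n -> R) A : set 'rV[R]_n :=
  [set x | A x /\ forall y, A y -> f y <= f x].

(* Differentiability at [x] relative to [A], with gradient [g]: values of [f]
   outside [A] play no role, so that boundary points of a closed box (such as
   the origin) are treated on a par with interior points.  The gradient is
   unique when the box has nonempty interior. *)
Definition is_gradient_within A (f : 'rV[R]_n -> R) x g : Prop :=
  (fun y => (f y - f x - dotv g (y - x)) / enorm (y - x))
    @ within A x^' --> (0 : R).

Definition submodular A (f : 'rV[R]_n -> R) : Prop :=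
  forall x y, A x -> A y -> f (vmax x y) + f (vmin x y) <= f x + f y.

Definition antitone_on A (G : 'rV[R]_n -> 'rV[R]_n) : Prop :=
  forall x y, A x -> A y -> vle x y -> vle (G y) (G x).

(* [G] is the gradient field of the differentiable function [f] on [A]. *)
Definition dr_submodular A (f : 'rV[R]_n -> R) (G : 'rV[R]_n -> 'rV[R]_n) :
    Prop :=
  submodular A f /\ antitone_on A G.

Definition elipschitz_on (L : R) A (G : 'rV[R]_n -> 'rV[R]_n) : Prop :=
  forall x y, A x -> A y -> enorm (G x - G y) <= L * enorm (x - y).

End Vectors.

(* These sets generate the Borel sigma-algebra of R^n. *)
Definition coord_preimages (R : realType) (n : nat) : set_system 'rV[R]_n :=
  [set A | exists (i : 'I_n) (B : set R),
     measurable B /\ A = (fun x : 'rV[R]_n => x 0 i) @^-1` B].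

Notation borel_rV R n := (g_sigma_algebraType (@coord_preimages R n)).

Section Sampling.
Context {R : realType} {dO dZ : measure_display}.
Context {Omega : measurableType dO} {Z : measurableType dZ}.
Variable (Pr : probability Omega R).
Implicit Types (z : nat -> {RV Pr >-> Z}).

Definition mutually_independent (I : set nat) z : Prop :=
  forall (s : seq nat) (B : nat -> set Z),
    uniq s -> (forall k, k \in s -> I k) -> (forall k, measurable (B k)) ->
    Pr (\bigcap_(k in [set` s]) (z k @^-1` B k)) =
      (\prod_(k <- s) Pr (z k @^-1` B k))%E.

(* z_1, z_2, ... are i.i.d. with law [P]; the index 0 is not used. *)
Definition iid_samples (P : probability Z R) z : Prop :=
  (forall k B, (0 < k)%N -> measurable B -> distribution Pr (z k) B = P B) /\
  mutually_independent [set k | (0 < k)%N] z.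

(* These events generate the sigma-algebra of z_1, ..., z_t, which is trivial
   for t = 0. *)
Definition sample_events z (t : nat) : set_system Omega :=
  [set A | exists (k : nat) (B : set Z),
     [/\ (0 < k <= t)%N, measurable B & A = z k @^-1` B]].

End Sampling.

(* A run of the method with [T] iterations, averaging parameters [rho] and
   stochastic gradients [G] on the samples [z].  Measurability of [v t] with
   respect to z_1, ..., z_t expresses that the maximizers are measurably
   selected without looking at future samples; at t = 0 it forces [v 0] to be
   constant. *)
Record nmscg (R : realType) (n : nat) (dO dZ : measure_display)
    (Omega : measurableType dO) (Z : measurableType dZ)
    (Pr : probability Omega R) (C : set 'rV[R]_n) (ubar : 'rV[R]_n)
    (G : 'rV[R]_n -> Z -> 'rV[R]_n) (T : nat) (rho : nat -> R)
    (z : nat -> {RV Pr >-> Z}) (x d v : nat -> Omega -> 'rV[R]_n) : Prop := {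
  nmscg_x0 : forall w, x 0%N w = 0 ;
  nmscg_d0 : forall w, d 0%N w = 0 ;
  nmscg_dS : forall t w, (0 < t < T)%N ->
    d t w = (1 - rho t) *: d t.-1 w + rho t *: G (x t w) (z t w) ;
  nmscg_v : forall t w, (t < T)%N ->
    argmax (dotv (d t w)) [set u | C u /\ vle u (ubar - x t w)] (v t w) ;
  nmscg_vmeas : forall t (i : 'I_n), (t < T)%N ->
    measurable_fun [set: g_sigma_algebraType (sample_events z t)]
      (fun w => v t w 0 i) ;
  nmscg_xS : forall t w, (t < T)%N ->
    x t.+1 w = x t w + T%:R^-1 *: v t w }.

(* Main.v *)
From HB Require Import structures.
Require Import Defs.
From mathcomp Require Import measurable_realfun ring lra.

(** The argument has a deterministic and a probabilistic half.

    Deterministic half.  Along nonnegative directions a function with antitone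
    gradient is concave.  Since [v t] fits into the room [ubar - x t], each
    iteration consumes at most the fraction [1 / T] of the room that is left, so
    [x t <= (1 - (1 - 1 / T) ^ t) ubar] ([iterate_room]); concavity and [F >= 0]
    then give [F (max (x t) xstar) >= (1 - 1 / T) ^ t * F xstar] ([dr_join_ge]).
    The point [max (x t) xstar - x t] competes with [v t] in the linear
    maximization, as [C] is down-closed; replacing the true gradient by its
    estimate [d t] costs [2 D] times the estimation error.  With the descent
    inequality this makes [F (x t)] satisfy an affine recursion
    ([progress_step]) whose solution is [path_bound]: on every trajectory,
    [F (x T)] is at least [(1 - 1 / T) ^ (T - 1) * F xstar], which exceeds
    [F xstar / e], minus [L D ^ 2 / (2 T)] and minus [2 D] times the average of
    the errors [e t = |gradF (x t) - d t|].

    Probabilistic half.  The iterate [x t.+1] and the estimate [d t] depend on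
    the first [t] samples only, hence are independent of the sample drawn next.
    Freezing the past ([freeze_past]) makes the new gradient noise a centred
    term of variance at most [sigma ^ 2], so that the mean square error obeys
    a contraction driven by noise and by the drift of the gradient ([err_step]).
    The weights [rho t] are tuned so that, for [T >= 8], its solution is at most
    [Q / (t + 8) ^ (2 / 3)] ([err_bound]).

    The two halves are joined by [2 y <= y ^ 2 / s + s], taken with the optimal
    [s] for each index, and by [sum_inv_cbrt].  The constant 15 leaves a
    margin: [T < 8] and [Q = 0] follow from the crude inequality [rough_bound],
    and elsewhere the error sum needs only 9, which leaves room for replacing
    [L], whose sign is arbitrary, by its absolute value. *)

Set Implicit Arguments.
Unset Strict Implicit.
Unset Printing Implicit Defensive.

Local Open Scope classical_set_scope.
Local Open Scope ring_scope.

(** * Euclidean geometry of row vectors *)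

Section Euclidean.
Context {R : realType} {n : nat}.
Implicit Types (x y g : 'rV[R]_n) (a : R).

Lemma dotvC x y : dotv x y = dotv y x.
Proof. by apply: eq_bigr => i _; rewrite mulrC. Qed.

Lemma dotvDl x y g : dotv (x + y) g = dotv x g + dotv y g.
Proof. by rewrite -big_split; apply: eq_bigr => i _; rewrite mxE mulrDl. Qed.

Lemma dotvDr x y g : dotv g (x + y) = dotv g x + dotv g y.
Proof. by rewrite dotvC dotvDl !(dotvC g). Qed.

Lemma dotvZl a x g : dotv (a *: x) g = a * dotv x g.
Proof. by rewrite mulr_sumr; apply: eq_bigr => i _; rewrite mxE mulrA. Qed.

Lemma dotvZr a x g : dotv g (a *: x) = a * dotv g x.
Proof. by rewrite dotvC dotvZl (dotvC g). Qed.

Lemma dotvNl x g : dotv (- x) g = - dotv x g.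
Proof. by rewrite -scaleN1r dotvZl mulN1r. Qed.

Lemma dotvNr x g : dotv g (- x) = - dotv g x.
Proof. by rewrite dotvC dotvNl (dotvC g). Qed.

Lemma dotv0r g : dotv g 0 = 0.
Proof. by rewrite -(scale0r g) dotvZr mul0r. Qed.

Definition dotvE := (dotvDl, dotvDr, dotvNl, dotvNr, dotvZl, dotvZr).

Lemma dotvv_ge0 x : 0 <= dotv x x.
Proof. by apply: sumr_ge0 => i _; rewrite -expr2 sqr_ge0. Qed.

Lemma sqr_enorm x : enorm x ^+ 2 = dotv x x.
Proof.
rewrite /enorm sqr_sqrtr; first by apply: eq_bigr => i _; rewrite expr2.
by apply: sumr_ge0 => i _; rewrite sqr_ge0.
Qed.

Lemma enorm_ge0 x : 0 <= enorm x.
Proof. exact: sqrtr_ge0. Qed.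

Lemma enorm0 : enorm (0 : 'rV[R]_n) = 0.
Proof. by apply/eqP; rewrite -sqrf_eq0 sqr_enorm dotv0r. Qed.

Lemma enorm_eq0 x : enorm x = 0 -> x = 0.
Proof.
move=> x0; have : dotv x x = 0 by rewrite -sqr_enorm x0 expr0n.
move=> /eqP; rewrite psumr_eq0; last by move=> i _; rewrite -expr2 sqr_ge0.
move=> /allP xx0; apply/rowP => i; rewrite mxE.
by have /(_ (mem_index_enum _)) := xx0 i; rewrite /= mulf_eq0 orbb => /eqP.
Qed.

Lemma enormZ a x : enorm (a *: x) = `|a| * enorm x.
Proof.
apply/eqP; rewrite -(eqrXn2 (n := 2)) ?mulr_ge0 ?enorm_ge0//.
by rewrite exprMn real_normK ?num_real// !sqr_enorm !dotvE mulrA -expr2.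
Qed.

Lemma enormN x : enorm (- x) = enorm x.
Proof. by rewrite -scaleN1r enormZ normrN1 mul1r. Qed.

(** Cauchy-Schwarz: expand the squared norm of [|y| ^ 2 x - (x . y) y]. *)
Lemma dotv_le_enorm x y : dotv x y <= enorm x * enorm y.
Proof.
have [/enorm_eq0 ->|y0] := eqVneq (enorm y) 0.
  by rewrite dotv0r mulr_ge0 ?enorm_ge0.
apply: le_trans (ler_norm _) _.
rewrite -(ler_pXn2r (n := 2)) ?nnegrE ?mulr_ge0 ?enorm_ge0//.
rewrite real_normK ?num_real// exprMn.
have y2 : 0 < enorm y ^+ 2 by rewrite exprn_gt0// lt_neqAle eq_sym y0 enorm_ge0.
rewrite -(ler_pM2l y2) -subr_ge0.
have := dotvv_ge0 (enorm y ^+ 2 *: x - dotv x y *: y).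
rewrite !dotvE -!sqr_enorm (dotvC y x).
by move=> h; apply: le_trans h _; rewrite le_eqVlt; apply/orP; left; apply/eqP; ring.
Qed.

Lemma dotv_ge_enorm x y : - (enorm x * enorm y) <= dotv x y.
Proof. by rewrite lerNl -dotvNl -[in leRHS]enormN dotv_le_enorm. Qed.

(** Expand [0 <= |a x - y| ^ 2] and divide by [a]. *)
Lemma sqr_enormD_le x y a : 0 < a ->
  enorm (x + y) ^+ 2 <= (1 + a) * enorm x ^+ 2 + (1 + a^-1) * enorm y ^+ 2.
Proof.
move=> a0; have := dotvv_ge0 (a *: x - y).
rewrite !sqr_enorm !dotvE (dotvC y x) => h.
rewrite -subr_ge0 -(pmulr_rge0 _ a0).
apply: le_trans h _; rewrite le_eqVlt; apply/orP; left; apply/eqP; field.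
by rewrite gt_eqF.
Qed.

Lemma ler_sqr_enorm x a : enorm x <= a -> enorm x ^+ 2 <= a ^+ 2.
Proof. by move=> xa; rewrite ler_pXn2r ?nnegrE ?enorm_ge0// (le_trans (enorm_ge0 x)). Qed.

Lemma norm_coord_le_enorm (h : 'rV[R]_n) i : `|h 0 i| <= enorm h.
Proof.
rewrite -[leLHS]sqrtr_sqr; apply: ler_wsqrtr.
by rewrite (bigD1 i)//= lerDl sumr_ge0// => j _; rewrite sqr_ge0.
Qed.

Lemma dotv_le x y g : vle 0 g -> vle x y -> dotv x g <= dotv y g.
Proof.
by move=> g0 xy; apply: ler_sum => i _; apply: ler_wpM2r; [have := g0 i; rewrite mxE|].
Qed.

End Euclidean.

(** * Differentiable functions on segments *)

Section Segments.
Context {R : realType} {n : nat}.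
Variables (A : set 'rV[R]_n) (F : 'rV[R]_n -> R) (gradF : 'rV[R]_n -> 'rV[R]_n).
Implicit Types (x h : 'rV[R]_n) (r s : R).
Hypothesis dF : forall y, A y -> is_gradient_within A F y (gradF y).

(** Relative differentiability transfers to the segment because moving the
    parameter by [k] moves the point by exactly [|k| * enorm h].  The expansion
    is uniform over both sides and includes the end points, so that it yields
    the derivative inside the segment and continuity up to its ends. *)
Lemma first_order_segment x h s : (forall r : R, 0 <= r <= 1 -> A (x + r *: h)) ->
  0 <= s <= 1 -> forall e, 0 < e -> exists2 del, 0 < del &
    forall r, 0 <= r <= 1 -> `|r - s| < del ->
      `|F (x + r *: h) - F (x + s *: h) - (r - s) * dotv (gradF (x + s *: h)) h|
      <= e * `|r - s|.
Proof.
move=> Axh s01 e e0.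
have [/enorm_eq0 ->|h0] := eqVneq (enorm h) 0.
  exists 1 => // r _ _; rewrite !scaler0 dotv0r mulr0 !subrr normr0.
  by rewrite mulr_ge0// ltW.
have {h0}h0 : 0 < enorm h by rewrite lt_neqAle eq_sym h0 enorm_ge0.
have /cvgr0Pnorm_lt/(_ (e / enorm h)) := dF (Axh _ s01).
rewrite divr_gt0// => /(_ isT); rewrite !near_withinE => /nbhs_ballP[del /= del0 ball_del].
exists (del / enorm h); first by rewrite divr_gt0.
move=> r r01; rewrite ltr_pdivlMr// => rs.
have [->|r_s] := eqVneq r s; first by rewrite !subrr mul0r subr0 normr0 mulr0.
have yE : x + r *: h - (x + s *: h) = (r - s) *: h.
  by rewrite opprD addrACA subrr add0r scalerBl.
have Ny : enorm (x + r *: h - (x + s *: h)) = `|r - s| * enorm h by rewrite yE enormZ.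
have Ny0 : 0 < `|r - s| * enorm h by rewrite mulr_gt0// normr_gt0 subr_eq0.
have := ball_del (x + r *: h).
rewrite Ny yE dotvZr normrM normfV (gtr0_norm Ny0) => H.
have {}H : `|F (x + r *: h) - F (x + s *: h) - (r - s) * dotv (gradF (x + s *: h)) h|
    / (`|r - s| * enorm h) < e / enorm h.
  apply: H; [|apply/eqP => xrs|exact: Axh]; last first.
    by move: Ny Ny0; rewrite xrs subrr enorm0 => <-; rewrite ltxx.
  split=> // i j; rewrite ord1 /ball/= -opprB normrN.
  have -> : (x + r *: h) 0 j - (x + s *: h) 0 j = (r - s) * h 0 j.
    by rewrite !mxE; ring.
  by rewrite normrM (le_lt_trans _ rs)// ler_wpM2l// norm_coord_le_enorm.
rewrite ltr_pdivrMr// in H.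
apply: ltW; rewrite (lt_le_trans H)// le_eqVlt; apply/orP; left; apply/eqP; field.
by rewrite gt_eqF.
Qed.

Lemma is_derive_segment x h s : (forall r : R, 0 <= r <= 1 -> A (x + r *: h)) ->
  0 < s < 1 ->
  is_derive s (1 : R) (fun r => F (x + r *: h)) (dotv (gradF (x + s *: h)) h).
Proof.
move=> Axh s01; have s01' : 0 <= s <= 1 by lra.
pose f (r : R) := F (x + r *: h).
pose d := dotv (gradF (x + s *: h)) h.
suff H : (fun k => k^-1 *: (f (k *: 1 + s) - f s)) @ (0 : R)^' --> d.
  by apply: DeriveDef; [exact: cvgP H | exact: cvg_lim H].
apply/cvgrPdist_le => e e0.
have [del del0 H] := first_order_segment Axh s01' e0.
near=> k.
have k0 : k != 0 by near: k; exact: nbhs_dnbhs_neq.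
have kd : `|k| < del by near: k; apply: dnbhs0_lt.
have ks : `|k| < s by near: k; apply: dnbhs0_lt; lra.
have k1 : `|k| < 1 - s by near: k; apply: dnbhs0_lt; lra.
have := H (k + s); rewrite addrK => /(_ _ kd); rewrite {}/f => Hk.
have {}Hk : `|F (x + (k + s) *: h) - F (x + s *: h) - k * d| <= e * `|k|.
  by apply: Hk; move: ks k1; rewrite !ltr_norml => /andP[? ?] /andP[? ?]; lra.
rewrite [k *: 1]mulr1 -(ler_pM2r (x := `|k|)) ?normr_gt0// -normrM.
rewrite -normrN; apply: le_trans Hk; rewrite le_eqVlt; apply/orP; left; apply/eqP; congr `|_|.
rewrite /GRing.scale/=; field.
by [].
Unshelve. all: by end_near. Qed.

Lemma within_continuous_segment x h : (forall r : R, 0 <= r <= 1 -> A (x + r *: h)) ->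
  {within `[0, 1], continuous (fun r : R => F (x + r *: h))}.
Proof.
move=> Axh; apply/subspace_continuousP => s /=; rewrite in_itv/= => s01.
apply/cvgrPdist_le => e e0.
set d := dotv (gradF (x + s *: h)) h.
have [del del0 H] := first_order_segment Axh s01 ltr01.
have d1 : 0 < 1 + `|d| by rewrite ltr_wpDr.
near=> r.
have r01 : 0 <= r <= 1.
  suff : r \in `[0, 1] by rewrite in_itv.
  by near: r; rewrite near_withinE; near=> r.
have rd : `|r - s| < del.
  near: r; rewrite near_withinE; near=> r => _; rewrite distrC.
  by near: r; exact: cvgr_dist_lt.
have re : `|r - s| <= e / (1 + `|d|).
  near: r; rewrite near_withinE; near=> r => _; rewrite distrC.
  by near: r; apply: cvgr_dist_le => //; rewrite divr_gt0.
rewrite distrC -(subrK ((r - s) * d) (_ - _)).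
apply: le_trans (ler_normD _ _) _; rewrite normrM.
rewrite ler_pdivlMr// in re.
apply: le_trans (lerD (H r r01 rd) (lexx _)) _; rewrite -/d.
by rewrite mul1r -[X in X + _]mulr1 -mulrDr.
Unshelve. all: by end_near. Qed.

Lemma segment_MVT x h : (forall r : R, 0 <= r <= 1 -> A (x + r *: h)) ->
  exists2 c, 0 < c < 1 & F (x + h) - F x = dotv (gradF (x + c *: h)) h.
Proof.
move=> Axh.
have [| |c] := @MVT R (fun r => F (x + r *: h))
    (fun r => dotv (gradF (x + r *: h)) h) 0 1 ltr01.
- by move=> s; rewrite in_itv/= => /(is_derive_segment Axh).
- exact: within_continuous_segment.
rewrite in_itv/= subr0 mulr1 scale1r scale0r addr0 => c01 Ec.
by exists c.
Qed.

(** Adding [L / 2 * |h| ^ 2 * r ^ 2] to [F (x + r h)] gives a function of [r]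
    whose derivative stays above its initial value, by the Lipschitz bound; the
    mean value theorem for this function keeps the sharp factor [1 / 2]. *)
Lemma lipschitz_gradient_lower L x h : 0 <= L -> elipschitz_on L A gradF ->
  (forall r : R, 0 <= r <= 1 -> A (x + r *: h)) ->
  F x + dotv (gradF x) h - L / 2 * enorm h ^+ 2 <= F (x + h).
Proof.
move=> L0 lip Axh.
pose k := L / 2 * enorm h ^+ 2.
pose q (r : R) := k * (r * r).
pose f (r : R) := F (x + r *: h).
pose df (r : R) := dotv (gradF (x + r *: h)) h.
have [| |c] := @MVT R (f \+ q) (fun r => df r + (k * (r + r))) 0 1 ltr01.
- move=> s; rewrite in_itv/= => s01.
  apply: is_deriveD; first exact: is_derive_segment.
  apply: is_derive_eq.
  by rewrite /= /GRing.scale/= !mulr1.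
- move=> s; apply: cvgD; first exact: within_continuous_segment.
  apply: (continuous_subspaceT (f := q)) => r; rewrite /q.
  by apply: cvgM; [exact: cvg_cst|apply: cvgM; exact: cvg_id].
rewrite in_itv/= /q /f subr0 !mulr1 mulr0 scale1r scale0r !addr0 mulr0 addr0 => c01 Ec.
have c01' : 0 <= c <= 1 by lra.
have Ax : A x by have := Axh 0; rewrite scale0r addr0; apply; rewrite lexx ler01.
have := dotv_ge_enorm (gradF (x + c *: h) - gradF x) h.
have : enorm (gradF (x + c *: h) - gradF x) <= L * (c * enorm h).
  have := lip _ _ (Axh c c01') Ax.
  by rewrite [x + _]addrC addrK enormZ ger0_norm//; case/andP: c01'.
move/(ler_wpM2r (enorm_ge0 h)); rewrite dotvDl dotvNl.
move: Ec; rewrite /df /k; set a := dotv _ _; set b := dotv _ _ ; set e := enorm h; nra.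
Qed.

End Segments.

(** * Functions with antitone gradient on a box *)

Section DiminishingReturns.
Context {R : realType} {n : nat}.
Variables (l u : 'rV[R]_n) (F : 'rV[R]_n -> R) (gradF : 'rV[R]_n -> 'rV[R]_n).
Let X := box l u.
Hypothesis dF : forall y, X y -> is_gradient_within X F y (gradF y).
Hypothesis antiF : antitone_on X gradF.
Implicit Types (x y h : 'rV[R]_n).

Lemma box_segment x h r : X x -> X (x + h) -> 0 <= r <= 1 -> X (x + r *: h).
Proof.
move=> [lx xu] [lxh xhu] r01; split=> i.
- by move: (lx i) (lxh i); rewrite !mxE => *; nra.
- by move: (xu i) (xhu i); rewrite !mxE => *; nra.
Qed.

(** The increment is the slope at an intermediate point, where the gradient lies
    between its values at [y] and at [x]. *)
Lemma dr_increment x y : X x -> X y -> vle x y ->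
  dotv (gradF y) (y - x) <= F y - F x <= dotv (gradF x) (y - x).
Proof.
move=> Xx Xy xy.
have yE : y = x + (y - x) by rewrite addrC subrK.
have seg r : 0 <= r <= 1 -> X (x + r *: (y - x)).
  by apply: box_segment => //; rewrite -yE.
have [c c01] := segment_MVT dF seg; rewrite -yE => ->.
have Xc : X (x + c *: (y - x)) by apply: seg; lra.
have xy0 : vle 0 (y - x) by move=> i; move: (xy i); rewrite !mxE; lra.
apply/andP; split; apply: dotv_le => //; apply: antiF => // i;
  by move: (xy i); rewrite !mxE => ?; nra.
Qed.

(** The increments on both sides of the intermediate point are compared with the
    gradient at that point. *)
Lemma dr_concave x h r : X x -> X (x + h) -> vle 0 h -> 0 <= r <= 1 ->
  (1 - r) * F x + r * F (x + h) <= F (x + r *: h).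
Proof.
move=> Xx Xxh h0 r01; have Xm := box_segment Xx Xxh r01.
have h0i i : 0 <= h 0 i by have := h0 i; rewrite mxE.
have xm : vle x (x + r *: h) by move=> i; move: (h0i i); rewrite !mxE => ?; nra.
have mxh : vle (x + r *: h) (x + h).
  by move=> i; move: (h0i i); rewrite !mxE => ?; nra.
have /andP[+ _] := dr_increment Xx Xm xm.
have /andP[_ +] := dr_increment Xm Xxh mxh.
have -> : x + r *: h - x = r *: h by rewrite [x + _]addrC addrK.
have -> : x + h - (x + r *: h) = (1 - r) *: h.
  by rewrite opprD addrACA subrr add0r scalerBl scale1r.
rewrite !dotvZr; nra.
Qed.

(** [vmax x y] lies at ratio [r] on the segment from [y] to
    [y + (vmax x y - y) / r], whose far end is still in the box because
    [x <= r u] and [y >= 0]; [dr_concave] and [F >= 0] at the far end conclude. *)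
Lemma dr_join_ge x y r : l = 0 -> (forall y, X y -> 0 <= F y) ->
  X x -> X y -> 0 <= r <= 1 -> vle x (r *: u) ->
  (1 - r) * F y <= F (vmax x y).
Proof.
move=> l0 F0 [lx xu] [ly yu] r01 xru.
have x0 i : 0 <= x 0 i by have := lx i; rewrite l0 mxE.
have y0 i : 0 <= y 0 i by have := ly i; rewrite l0 mxE.
have [r0|r0] := eqVneq r 0.
  rewrite r0 subr0 mul1r (_ : vmax x y = y)//.
  apply/rowP => i; rewrite mxE max_r//; have := xru i.
  by rewrite r0 scale0r mxE => /le_trans; apply.
have {}r0 : 0 < r by rewrite lt_neqAle eq_sym r0; case/andP: r01.
have ri : 0 < r^-1 by rewrite invr_gt0.
pose h := r^-1 *: (vmax x y - y).
have mE : vmax x y = y + r *: h by rewrite scalerA divff ?gt_eqF// scale1r addrC subrK.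
have h0 : vle 0 h.
  move=> i; rewrite !mxE mulr_ge0 ?(ltW ri)//.
  by rewrite subr_ge0 le_max lexx orbT.
have Xyh : X (y + h).
  split=> i; first by rewrite mxE (le_trans (ly i))// lerDl; have := h0 i; rewrite mxE.
  rewrite !mxE; case: (leP (x 0 i) (y 0 i)) => xy; first by rewrite subrr mulr0 addr0.
  rewrite -lerBrDl mulrC ler_pdivrMr//.
  move: (xru i) (yu i) (y0 i); rewrite mxE => *; nra.
rewrite mE; apply: le_trans (dr_concave _ Xyh h0 r01); last by [].
by rewrite lerDl mulr_ge0 ?F0//; case/andP: r01.
Qed.

End DiminishingReturns.

(** * One trajectory of the method *)

(** For [T >= 2], [1 - 1 / T = (1 + 1 / (T - 1))^-1 >= exp (- 1 / (T - 1))].  The exponent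
    [T - 1] is essential, as [(1 - 1 / T) ^ T] is smaller than [1 / e]. *)
Lemma expRN1_le_exp {R : realType} (T : nat) : (0 < T)%N ->
  expR (- 1) <= (1 - T%:R^-1) ^+ T.-1 :> R.
Proof.
case: T => // -[|m] _; first by rewrite expr0 expR_le1; lra.
have m1 : 0 < m.+1%:R :> R by rewrite ltr0n.
have -> : expR (- 1) = expR (- m.+1%:R^-1) ^+ m.+1 :> R.
  by rewrite -expRM_natl mulrN divff ?gt_eqF.
have -> : 1 - m.+2%:R^-1 = (1 + m.+1%:R^-1)^-1 :> R.
  by rewrite -[m.+2%:R]natr1; field; rewrite gt_eqF//= gt_eqF// ltr_wpDl// ltW.
rewrite expRN /= ler_pXn2r ?nnegrE ?invr_ge0 ?addr_ge0 ?invr_ge0 ?expR_ge0 ?(ltW m1)//.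
by rewrite lef_pV2 ?posrE ?expR_gt0 ?expR_ge1Dx// addr_gt0 ?invr_gt0.
Qed.

Section Path.
Context {R : realType} {n : nat}.
Variables (u : 'rV[R]_n) (C : set 'rV[R]_n).
Variables (F : 'rV[R]_n -> R) (gradF : 'rV[R]_n -> 'rV[R]_n).
Variables (D L : R) (T : nat) (x d v : nat -> 'rV[R]_n) (xstar : 'rV[R]_n).
Let X := box 0 u.
Hypothesis CX : C `<=` X.
Hypothesis convC : forall y1 y2 a, C y1 -> C y2 -> 0 <= a <= 1 ->
  C (a *: y1 + (1 - a) *: y2).
Hypothesis C0 : C 0.
Hypothesis downC : down_closed C.
Hypothesis normC : forall y, C y -> enorm y <= D.
Hypothesis dF : forall y, X y -> is_gradient_within X F y (gradF y).
Hypothesis antiF : antitone_on X gradF.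
Hypothesis F0 : forall y, X y -> 0 <= F y.
Hypothesis L0 : 0 <= L.
Hypothesis lipF : elipschitz_on L X gradF.
Hypothesis Cxs : C xstar.
Hypothesis T0 : (0 < T)%N.
Hypothesis x0 : x 0%N = 0.
Hypothesis vP : forall t, (t < T)%N ->
  argmax (dotv (d t)) [set w | C w /\ vle w (u - x t)] (v t).
Hypothesis xS : forall t, (t < T)%N -> x t.+1 = x t + T%:R^-1 *: v t.

Let TR : 0 < T%:R :> R. Proof. by rewrite ltr0n. Qed.

Let Cv t : (t < T)%N -> C (v t). Proof. by move=> /vP[[]]. Qed.

Let C_ge0 y : C y -> forall i, 0 <= y 0 i.
Proof. by move=> /CX[y0 _] i; have := y0 i; rewrite mxE. Qed.

(** [x t] is [t / T] times the average of [v 0], ..., [v (t - 1)], hence lies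
    between 0 and a point of [C]. *)
Lemma iterate_feasible t : (t <= T)%N -> C (x t).
Proof.
move=> tT.
suff [c Cc ->] : exists2 c, C c & x t = (t%:R / T%:R) *: c.
  apply: (downC Cc) => i; rewrite !mxE; have := C_ge0 Cc i.
    by move=> ?; rewrite mulr_ge0// divr_ge0.
  move=> ?; apply: ler_piMl => //.
  by rewrite ler_pdivrMr// mul1r ler_nat.
elim: t tT => [|t IH] tT; first by exists 0 => //; rewrite x0 scaler0.
have [c Cc xE] := IH (ltnW tT).
have t1 : 0 < t.+1%:R :> R by rewrite ltr0n.
exists ((t%:R / t.+1%:R) *: c + (1 - t%:R / t.+1%:R) *: v t).
  apply: convC => //; first exact: Cv.
  by apply/andP; rewrite divr_ge0// ler_pdivrMr// mul1r ler_nat.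
rewrite xS// xE scalerDr !scalerA; congr (_ *: _ + _ *: _).
  by field; rewrite !gt_eqF.
by rewrite -natr1; field; rewrite natr1 !gt_eqF.
Qed.

Let q := 1 - T%:R^-1 : R.

Let q01 : 0 <= q <= 1.
Proof. by apply/andP; rewrite subr_ge0 gerBl invr_ge0 (ltW TR) invf_le1// ler1n. Qed.

(** [u - x t.+1 >= (1 - 1 / T) (u - x t)], since [v t <= u - x t]. *)
Lemma iterate_room t : (t <= T)%N -> vle (x t) ((1 - q ^+ t) *: u).
Proof.
elim: t => [|t IH] tT i; first by rewrite x0 expr0 subrr scale0r.
have [[_ /(_ i)]] := vP tT; rewrite xS// !mxE exprS => vi _.
have := IH (ltnW tT) i; rewrite mxE => xi.
have -> : (1 - q * q ^+ t) * u 0 i = q * ((1 - q ^+ t) * u 0 i) + T%:R^-1 * u 0 i.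
  by rewrite /q; ring.
apply: le_trans (_ : q * x t 0 i + T%:R^-1 * u 0 i <= _); last first.
  by rewrite lerD2r ler_wpM2l//; case/andP: q01.
have : T%:R^-1 * v t 0 i <= T%:R^-1 * (u 0 i - x t 0 i) by rewrite ler_wpM2l// invr_ge0 ltW.
rewrite /q; lra.
Qed.

Let e t := enorm (gradF (x t) - d t).

(** The competitor [w = vmax (x t) xstar - x t] is feasible for the linear
    problem solved by [v t]: it is below [xstar], and [x t + w] is in the box.
    Its true slope is at least [F (vmax (x t) xstar) - F (x t)], and passing from
    slopes along [gradF (x t)] to slopes along [d t] costs [D * e t] for [w] and
    once more for [v t]. *)
Lemma progress_step t : (t < T)%N ->
  q * F (x t) + T%:R^-1 * (q ^+ t * F xstar - (2 * D * e t + L * D ^+ 2 / (2 * T%:R)))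
    <= F (x t.+1).
Proof.
move=> tT.
have Cx := iterate_feasible (ltnW tT).
have Xx := CX Cx.
have Xs := CX Cxs.
have Ti : 0 <= T%:R^-1 :> R by rewrite invr_ge0 ltW.
pose y := vmax (x t) xstar.
have yx i : (y - x t) 0 i = Num.max (x t 0 i) (xstar 0 i) - x t 0 i by rewrite !mxE.
have xy : vle (x t) y by move=> i; rewrite !mxE le_max lexx.
have Xy : X y.
  split=> i; first by apply: le_trans (xy i); case: Xx.
  by rewrite mxE ge_max; case: Xx => _ ->; case: Xs => _ ->.
have Cw : C (y - x t).
  apply: (downC Cxs) => i; first by rewrite yx mxE subr_ge0; have := xy i; rewrite !mxE.
  rewrite yx lerBlDr ge_max lerDr lerDl.
  by rewrite (C_ge0 Cxs) (C_ge0 Cx).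
have [[_ vle_u] vmaxi] := vP tT.
have dw : dotv (d t) (y - x t) <= dotv (d t) (v t).
  apply: vmaxi; split=> // i.
  by have [_ /(_ i)] := Xy; rewrite !mxE lerD2r.
have join : q ^+ t * F xstar <= F y.
  have := dr_join_ge dF antiF (erefl _) F0 Xx Xs _ (iterate_room (ltnW tT)).
  rewrite subKr; apply; rewrite subr_ge0 gerBl.
  by case/andP: q01 => q0 q1; rewrite exprn_ge0// exprn_ile1.
have /andP[_ incr] := dr_increment dF antiF Xx Xy xy.
have err1 := dotv_ge_enorm (d t - gradF (x t)) (y - x t).
have err2 := dotv_ge_enorm (gradF (x t) - d t) (v t).
rewrite -enormN opprB -/(e t) in err1.
rewrite -/(e t) in err2.
have e0 : 0 <= e t := enorm_ge0 _.
have {}err1 : - (e t * D) <= dotv (d t - gradF (x t)) (y - x t).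
  by apply: le_trans err1; rewrite lerN2 ler_wpM2l// normC.
have {}err2 : - (e t * D) <= dotv (gradF (x t) - d t) (v t).
  by apply: le_trans err2; rewrite lerN2 ler_wpM2l// normC//; exact: Cv.
have gain : F y - F (x t) - 2 * D * e t <= dotv (gradF (x t)) (v t).
  by move: err1 err2; rewrite !(dotvDl, dotvNl); lra.
have seg r : 0 <= r <= 1 -> X (x t + r *: (T%:R^-1 *: v t)).
  by apply: box_segment => //; rewrite -xS//; exact/CX/iterate_feasible.
have := lipschitz_gradient_lower dF L0 lipF seg.
rewrite -xS// dotvZr enormZ ger0_norm// => descent.
have v2 : enorm (v t) ^+ 2 <= D ^+ 2 by apply/ler_sqr_enorm/normC/Cv.
have gain' : T%:R^-1 * (q ^+ t * F xstar - F (x t) - 2 * D * e t) <=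
    T%:R^-1 * dotv (gradF (x t)) (v t).
  by rewrite ler_wpM2l//; lra.
have smooth : L / 2 * (T%:R^-1 * enorm (v t)) ^+ 2 <= T%:R^-1 * (L * D ^+ 2 / (2 * T%:R)).
  have -> : T%:R^-1 * (L * D ^+ 2 / (2 * T%:R)) = L / 2 * T%:R^-1 ^+ 2 * D ^+ 2.
    by field; rewrite gt_eqF.
  by rewrite exprMn mulrA ler_wpM2l// mulr_ge0 ?divr_ge0 ?exprn_ge0.
by rewrite /q; lra.
Qed.

(** Solution of the recursion [progress_step].  At [t = 0] the factor [t / T]
    vanishes, so the truncated exponent [t.-1] does no harm. *)
Lemma path_bound_aux t : (t <= T)%N ->
  t%:R / T%:R * q ^+ t.-1 * F xstar
    - T%:R^-1 * \sum_(s < t) (2 * D * e s + L * D ^+ 2 / (2 * T%:R)) <= F (x t).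
Proof.
have Fs0 : 0 <= F xstar by apply/F0/CX.
have D0 : 0 <= D by apply: le_trans (normC C0); exact: enorm_ge0.
have Ti : 0 <= T%:R^-1 :> R by rewrite invr_ge0 ltW.
elim: t => [|t IH] tT.
  by rewrite big_ord0 mulr0 !mul0r subr0 F0// x0; exact: CX.
apply: le_trans (progress_step tT); rewrite big_ord_recr/=.
set S := \sum_(i < t) _ in IH *.
have S0 : 0 <= S.
  apply: sumr_ge0 => i _; apply: addr_ge0; first by rewrite !mulr_ge0 ?enorm_ge0.
  by rewrite divr_ge0 ?mulr_ge0 ?exprn_ge0.
have {}IH := IH (ltnW tT).
have /(ler_wpM2l (proj1 (andP q01))) := IH.
have -> : q * (t%:R / T%:R * q ^+ t.-1 * F xstar - T%:R^-1 * S) =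
   t%:R / T%:R * q ^+ t * F xstar - q * (T%:R^-1 * S).
  case: t tT @S S0 IH => [|t] tT S S0 IH; first by rewrite !mul0r; ring.
  by rewrite /= exprS; ring.
have : q * (T%:R^-1 * S) <= T%:R^-1 * S.
  by rewrite ler_piMl ?mulr_ge0//; case/andP: q01.
rewrite -natr1 mulrDl mul1r; lra.
Qed.

Lemma path_bound :
  expR (- 1) * F xstar - L * D ^+ 2 / (2 * T%:R)
    - T%:R^-1 * \sum_(s < T) (2 * D * e s) <= F (x T).
Proof.
apply: le_trans (path_bound_aux (leqnn T)).
have Fs0 : 0 <= F xstar by apply/F0/CX.
rewrite divff ?gt_eqF// mul1r big_split/= sumr_const card_ord.
have -> : T%:R^-1 * (\sum_(s < T) (2 * D * e s) + (L * D ^+ 2 / (2 * T%:R)) *+ T) =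
  T%:R^-1 * \sum_(s < T) (2 * D * e s) + L * D ^+ 2 / (2 * T%:R).
  by rewrite -[X in _ + X]mulr_natl; field; rewrite gt_eqF.
suff : expR (- 1) <= q ^+ T.-1 by move=> /(ler_wpM2r Fs0); lra.
exact: expRN1_le_exp.
Qed.

(** Both values are compared with [F 0]: from above by concavity, from below by
    smoothness. *)
Lemma rough_bound y : C y ->
  expR (- 1) * F xstar - 2 * enorm (gradF 0) * D - L * D ^+ 2 / 2 <= F y.
Proof.
move=> Cy.
have D0 : 0 <= D by apply: le_trans (normC C0); exact: enorm_ge0.
have X0 := CX C0.
have Fs0 : 0 <= F xstar by apply/F0/CX.
have g0 := enorm_ge0 (gradF 0).
have up : F xstar - F 0 <= enorm (gradF 0) * D.
  have xs0 : vle 0 xstar by move=> i; rewrite mxE C_ge0.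
  have /andP[_ /le_trans] := dr_increment dF antiF X0 (CX Cxs) xs0; apply.
  by rewrite subr0 (le_trans (dotv_le_enorm _ _))// ler_wpM2l// normC.
have seg r : 0 <= r <= 1 -> X (0 + r *: y).
  by apply: box_segment => //; rewrite add0r; exact: CX.
have := lipschitz_gradient_lower dF L0 lipF seg; rewrite add0r.
have := dotv_ge_enorm (gradF 0) y.
have : enorm (gradF 0) * enorm y <= enorm (gradF 0) * D by rewrite ler_wpM2l// normC.
have : L / 2 * enorm y ^+ 2 <= L / 2 * D ^+ 2.
  by rewrite ler_wpM2l ?divr_ge0//; apply/ler_sqr_enorm/normC.
have : expR (- 1) * F xstar <= F xstar by rewrite ler_piMl// expR_le1; lra.
lra.
Qed.

End Path.

(** * The averaging schedule *)

Section CubeRoots.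
Context {R : realType}.

Definition cbrt (a : R) : R := a `^ (1 / 3).

Lemma cbrt_ge0 a : 0 <= cbrt a. Proof. exact: powR_ge0. Qed.

Lemma cbrtK a : 0 <= a -> cbrt a ^+ 3 = a.
Proof.
move=> a0; rewrite -powR_mulrn ?cbrt_ge0// /cbrt -powRrM.
by rewrite (_ : 1 / 3 * 3%:R = 1) ?powRr1//; field.
Qed.

Lemma powR23 a : a `^ (2 / 3) = cbrt a ^+ 2.
Proof.
by rewrite -powR_mulrn ?cbrt_ge0// /cbrt -powRrM (_ : 2 / 3 = 1 / 3 * 2%:R)//; field.
Qed.

Let c t := cbrt (t%:R + 8).

Lemma cbrt_shift t : [/\ 2 <= c t, c t <= c t.+1 & c t.+1 ^+ 3 = c t ^+ 3 + 1].
Proof.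
have c3 s : c s ^+ 3 = s%:R + 8 by rewrite cbrtK// addr_ge0.
have cS : c t.+1 ^+ 3 = c t ^+ 3 + 1 by rewrite !c3 -natr1; ring.
have c0 : 0 <= c t := cbrt_ge0 _.
have c1 : 0 <= c t.+1 := cbrt_ge0 _.
split=> //.
  rewrite -(ler_pXn2r (n := 3)) ?nnegrE// c3 (_ : 2 ^+ 3 = 8); last by ring.
  by rewrite lerDr.
by rewrite -(ler_pXn2r (n := 3)) ?nnegrE// cS lerDl.
Qed.

Lemma cbrt_shift0 : c 0%N = 2.
Proof.
have [c2 _ _] := cbrt_shift 0; have : c 0%N ^+ 3 = 8 by rewrite cbrtK// add0r.
by move=> h; apply/eqP; rewrite eq_le c2 andbT; nra.
Qed.

(** With [b ^ 3 - a ^ 3 = 1] and [a >= 1],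
    [b ^ 2 - a ^ 2 = (a + b) / (a ^ 2 + a b + b ^ 2) <= 1]. *)
Lemma sqr_cbrt_shift t : c t.+1 ^+ 2 <= c t ^+ 2 + 1.
Proof.
have [] := cbrt_shift t; set a := c t; set b := c t.+1 => a2 ab e.
have ba : (b - a) * (b ^+ 2 + a * b + a ^+ 2) = 1.
  by rewrite (_ : _ * _ = b ^+ 3 - a ^+ 3); [rewrite e; ring|ring].
have ab0 : 0 <= b - a by rewrite subr_ge0.
have : b + a <= b ^+ 2 + a * b + a ^+ 2 by nra.
move=> /(ler_wpM2l ab0); rewrite ba; lra.
Qed.

(** With [w = c t.+1 ^ 2] and [w' = c t ^ 2], clearing denominators leaves
    [w (w - 2) + w' <= w w'], which holds because [w - 1 <= w' <= w]. *)
Lemma contraction_step t q : 0 <= q ->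
  (1 - 2 / c t.+1 ^+ 2) * (q / c t ^+ 2) + q / c t.+1 ^+ 4 <= q / c t.+1 ^+ 2.
Proof.
move=> q0; have := sqr_cbrt_shift t.
have [c2 cS _] := cbrt_shift t; rewrite (exprM _ 2 2).
have : c t ^+ 2 <= c t.+1 ^+ 2 by rewrite ler_pXn2r ?nnegrE//; lra.
have : 4 <= c t ^+ 2 by nra.
set w := c t.+1 ^+ 2; set w' := c t ^+ 2 => w4 ww' w'1.
rewrite -subr_ge0 (_ : _ - _ = q * ((w * w' - w * (w - 2) - w') / (w ^+ 2 * w'))); last first.
  by field; apply/andP; split; lra.
rewrite mulr_ge0// divr_ge0//; first by nra.
by rewrite mulr_ge0 ?sqr_ge0//; lra.
Qed.

(** Telescoping of [1 / a <= 2 (b ^ 2 - a ^ 2)] for consecutive cube roots; the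
    constant of the integral comparison would be [3 / 2]. *)
Lemma sum_inv_cbrt T : \sum_(t < T) (c t)^-1 <= 2 * c T ^+ 2 - 8.
Proof.
elim: T => [|t IH]; first by rewrite big_ord0 cbrt_shift0; lra.
rewrite big_ord_recr/=; apply: le_trans (lerD IH (lexx _)) _.
have [] := cbrt_shift t; set a := c t; set b := c t.+1 => a2 ab e.
suff : a^-1 <= 2 * (b ^+ 2 - a ^+ 2) by lra.
have a0 : 0 < a by lra.
rewrite -(ler_pM2l a0) divff ?gt_eqF//.
have ba : (b - a) * (b ^+ 2 + a * b + a ^+ 2) = 1.
  by rewrite (_ : _ * _ = b ^+ 3 - a ^+ 3); [rewrite e; ring|ring].
have := sqr_cbrt_shift t; rewrite -/a -/b => b1.
have ab0 : 0 <= b - a by rewrite subr_ge0.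
have : b ^+ 2 + a * b + a ^+ 2 <= 2 * a * (b + a) by nra.
move=> /(ler_wpM2l ab0); rewrite ba; lra.
Qed.

End CubeRoots.

(** * Independence of the past and the next sample *)

Section Freezing.
Local Open Scope ereal_scope.
Context {R : realType} {dO d1 d2 : measure_display}.
Context {Omega : measurableType dO} {S : measurableType d1}.
Context {Z : measurableType d2} (Pr : probability Omega R).

(** Independence says that the law of the pair is the product of the laws;
    Tonelli then integrates [Y] out with [X] frozen. *)
Lemma integral_independent_pair (X : {mfun Omega >-> S}) (Y : {mfun Omega >-> Z})
    (f : S * Z -> \bar R) :
  (forall A B, measurable A -> measurable B ->
     Pr (X @^-1` A `&` Y @^-1` B) = Pr (X @^-1` A) * Pr (Y @^-1` B)) ->
  measurable_fun [set: S * Z] f -> (forall p, 0 <= f p) ->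
  \int[Pr]_w f (X w, Y w) =
  \int[Pr]_w \int[distribution Pr Y]_s f (X w, s).
Proof.
move=> indep mf f0.
have mXY : measurable_fun setT (fun w => (X w, Y w)).
  by apply/measurable_fun_pair; exact: measurable_funPT.
transitivity (\int[pushforward Pr (fun w => (X w, Y w))]_p f p).
  by rewrite ge0_integral_pushforward.
transitivity (\int[distribution Pr X \x distribution Pr Y]_p f p).
  apply: eq_measure_integral => A mA _.
  symmetry.
  by apply: product_measure_unique => // B1 B2 mB1 mB2; exact: indep.
rewrite fubini_tonelli1//.
rewrite ge0_integral_distribution//.
- exact: measurable_fun_fubini_tonelli_F.
- by move=> y; apply: integral_ge0 => s _.
Qed.

End Freezing.

Section Past.
Local Open Scope ereal_scope.
Context {R : realType} {dO dZ : measure_display}.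
Context {Omega : measurableType dO} {Z : measurableType dZ}.
Context (Pr : probability Omega R) (z : nat -> {RV Pr >-> Z}).

Lemma sub_past t A : <<s sample_events z t >> A -> measurable A.
Proof.
apply: smallest_sub; first exact: sigma_algebra_measurable.
by move=> _ [k [B [_ mB ->]]]; rewrite -[X in measurable X]setTI; exact: measurable_funPT.
Qed.

(** The cylinders fixing [z 1], ..., [z t] form a pi-system that generates the
    past and consists of events independent of [z t.+1]; Dynkin's theorem
    extends independence to the whole sigma-algebra. *)
Lemma past_independent t A (B : set Z) :
  mutually_independent [set k | (0 < k)%N] z ->
  <<s sample_events z t >> A -> measurable B ->
  Pr (A `&` z t.+1 @^-1` B) = Pr A * Pr (z t.+1 @^-1` B).
Proof.
move=> indep sA mB.
pose cyl (E : nat -> set Z) := \bigcap_(k in [set` iota 1 t]) (z k @^-1` E k).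
pose Cyl := [set A | exists2 E : nat -> set Z, (forall k, measurable (E k)) & A = cyl E].
have mz k (E : set Z) : measurable E -> measurable (z k @^-1` E).
  by move=> mE; rewrite -[X in measurable X]setTI; exact: measurable_funPT.
have mcyl E : (forall k, measurable (E k)) -> measurable (cyl E).
  by move=> mE; apply: fin_bigcap_measurable => // k _; exact: mz.
pose H := [set A : set Omega | measurable A /\
  Pr (A `&` z t.+1 @^-1` B) = Pr A * Pr (z t.+1 @^-1` B)].
have fP (A' : set Omega) : measurable A' -> Pr A' \is a fin_num by move=> ?; exact: fin_num_measure.
suff : <<s Cyl >> `<=` H.
  move=> /(_ A) []//.
  apply: sub_sigma_algebra2 A sA => _ [k [E [kt mE ->]]].
  exists (fun j => if j == k then E else setT); first by move=> j; case: ifP.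
  rewrite /cyl; apply/seteqP; split => [w zw j _ /=|w /(_ k)/=]; first by case: eqP => [->|].
  by rewrite eqxx; apply; rewrite mem_iota add1n ltnS.
apply: lambda_system_subset => //.
- move=> _ _ [E1 mE1 ->] [E2 mE2 ->]; exists (fun k => E1 k `&` E2 k); last first.
    by rewrite /cyl -bigcapI.
  by move=> k; exact: measurableI.
- split => //.
  + by split; [exact: measurableT|rewrite setTI probability_setT mul1e].
  + move=> A1 A2 A21 [mA1 e1] [mA2 e2]; split; first exact: measurableD.
    have -> : (A1 `\` A2) `&` z t.+1 @^-1` B =
        (A1 `&` z t.+1 @^-1` B) `\` (A2 `&` z t.+1 @^-1` B).
      by apply/seteqP; split => w /=; tauto.
    have mI C : measurable C -> measurable (C `&` z t.+1 @^-1` B).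
      by move=> mC; apply: measurableI => //; exact: mz.
    have ltP C : measurable C -> Pr C < +oo by move=> mC; rewrite -ge0_fin_numE// fP.
    have PrD B1 B2 : measurable B1 -> measurable B2 -> B2 `<=` B1 ->
        Pr (B1 `\` B2) = Pr B1 - Pr B2.
      by move=> mB1 mB2 B21; rewrite measureD ?ltP// (setIidr B21).
    rewrite !PrD//; [|exact: mI|exact: mI|exact: setSI].
    rewrite e1 e2 muleBl//; first by apply: fP; exact: mz.
    by rewrite fin_num_adde_defr// fP.
  + move=> F ndF HF.
    have mF i : measurable (F i) by case: (HF i).
    have mU : measurable (\bigcup_i F i) by exact: bigcup_measurable.
    split => //.
    rewrite setI_bigcupl.
    have mFB i : measurable (F i `&` z t.+1 @^-1` B) by apply: measurableI => //; exact: mz.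
    have cvl : Pr (F i `&` z t.+1 @^-1` B) @[i --> \oo] -->
        Pr (\bigcup_i (F i `&` z t.+1 @^-1` B)).
      apply: nondecreasing_cvg_mu => //; first exact: bigcup_measurable.
      by move=> i j ij; apply/subsetPset; apply: setSI; apply/subsetPset; exact: ndF.
    have cvr : Pr (F i `&` z t.+1 @^-1` B) @[i --> \oo] -->
        Pr (\bigcup_i F i) * Pr (z t.+1 @^-1` B).
      under eq_cvg do rewrite (HF _).2.
      by apply: cvgeZr; [apply: fP; exact: mz|exact: nondecreasing_cvg_mu].
    exact: cvg_unique cvl cvr.
- move=> _ [E mE ->]; split; first exact: mcyl.
  pose E' k := if k == t.+1 then B else E k.
  have mE' k : measurable (E' k) by rewrite /E'; case: ifP.
  have E'E k : k \in iota 1 t -> E' k = E k.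
    by rewrite mem_iota add1n ltnS /E' => /andP[_ kt]; case: eqP kt => // ->; rewrite ltnn.
  have posI k : k \in iota 1 t -> (0 < k)%N by rewrite mem_iota => /andP[].
  have e1 := indep (iota 1 t) E' (iota_uniq _ _) posI mE'.
  have e2 : Pr (\bigcap_(k in [set` t.+1 :: iota 1 t]) (z k @^-1` E' k)) =
      \prod_(k <- t.+1 :: iota 1 t) Pr (z k @^-1` E' k).
    apply: indep => //=.
    - by rewrite iota_uniq andbT mem_iota add1n ltnn andbF.
    - by move=> k; rewrite inE => /predU1P[->//|/posI].
  have cylE : cyl E = \bigcap_(k in [set` iota 1 t]) (z k @^-1` E' k).
    by apply: eq_bigcapr => k /E'E ->.
  rewrite cylE e1 muleC.
  have -> : z t.+1 @^-1` B = z t.+1 @^-1` E' t.+1 by rewrite /E' eqxx.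
  rewrite -(big_cons _ _ t.+1 (iota 1 t) xpredT (fun k => Pr (z k @^-1` E' k))) -e2.
  congr (Pr _); apply/seteqP; split => [w [wE wB] k|w wE].
    by rewrite /= inE => /predU1P[->|/wE].
  by split => [k kt|]; apply: wE; rewrite /= inE ?kt ?orbT ?eqxx.
Qed.

End Past.

Section PastMeasurability.
Context {R : realType} {dO dZ : measure_display}.
Context {Omega : measurableType dO} {Z : measurableType dZ}.
Context {Pr : probability Omega R} (z : nat -> {RV Pr >-> Z}).

Local Notation past t := (g_sigma_algebraType (sample_events z t)).

Lemma past_widen s t (f : Omega -> R) : (s <= t)%N ->
  measurable_fun [set: past s] f -> measurable_fun [set: past t] f.
Proof.
move=> st mf _ B mB.
apply: sub_sigma_algebra2 (mf measurableT B mB) => _ [k [E [/andP[k0 ks] mE ->]]].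
by exists k, E; rewrite k0 (leq_trans ks st).
Qed.

Lemma past_ambient t (f : Omega -> R) :
  measurable_fun [set: past t] f -> measurable_fun [set: Omega] f.
Proof. by move=> mf _ B mB; exact: sub_past (mf measurableT B mB). Qed.

Lemma measurable_past_sample k t : (0 < k <= t)%N ->
  measurable_fun [set: past t] (z k).
Proof.
move=> kt _ B mB; rewrite setTI.
by apply: sub_sigma_algebra; exists k, B.
Qed.

(** [integral_independent_pair] with the identity, seen as a random variable with
    values in the sample space equipped with the past sigma-algebra: [f] may be
    any function of the past and of one fresh sample, and its inner integral is
    the conditional expectation given the past. *)
Lemma freeze_past (P : probability Z R) t (f : past t * Z -> \bar R) :
  iid_samples P z -> measurable_fun [set: past t * Z] f -> (forall p, 0 <= f p)%E ->
  (\int[Pr]_w f (w, z t.+1 w) = \int[Pr]_w \int[P]_s f (w, s))%E.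
Proof.
move=> [law indep] mf f0.
have mid : measurable_fun [set: Omega] (id : Omega -> past t).
  by move=> _ B mB; rewrite setTI; exact: sub_past mB.
pose X : {mfun Omega >-> past t} := HB.pack (id : Omega -> past t)
  (isMeasurableFun.Build _ _ _ _ _ mid).
rewrite (@integral_independent_pair _ _ _ _ _ _ _ Pr X (z t.+1))//; last first.
  by move=> A B mA mB; exact: past_independent.
apply: eq_integral => w _; apply: eq_measure_integral => A mA _.
exact: law.
Qed.

End PastMeasurability.

(** * Measurability of vector-valued maps *)

Lemma measurable_sqr_enorm {R : realType} {n : nat} d (S : measurableType d) (Y : S -> 'rV[R]_n) :
  (forall i, measurable_fun setT (fun s => Y s 0 i)) ->
  measurable_fun setT (fun s => enorm (Y s) ^+ 2).
Proof.
move=> mY; under eq_fun do rewrite sqr_enorm.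
by apply: measurable_sum => i; exact: measurable_funM.
Qed.

Section VectorMeasurability.
Context {R : realType} {n : nat} {dS dZ : measure_display}.
Context {S : measurableType dS} {Z : measurableType dZ}.
Variables (l u : 'rV[R]_n) (G : 'rV[R]_n -> Z -> 'rV[R]_n).
Let X := box l u.
Hypothesis mG : forall i : 'I_n, measurable_fun [set p : borel_rV R n * Z | X p.1]
  (fun p => G p.1 p.2 0 i).

Lemma measurable_rV (Y : S -> 'rV[R]_n) :
  (forall i, measurable_fun [set: S] (fun s => Y s 0 i)) ->
  measurable_fun [set: S] (Y : S -> borel_rV R n).
Proof.
move=> mY; apply: (@measurability _ _ S (borel_rV R n) setT Y (@coord_preimages R n)) => //.
move=> _ [_ [i [B [mB ->]]] <-].
exact: mY.
Qed.

Lemma measurable_box : measurable (box l u : set (borel_rV R n)).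
Proof.
rewrite (_ : box l u = \bigcap_(i in [set: 'I_n])
    ((fun x : 'rV[R]_n => x 0 i) @^-1` `[l 0 i, u 0 i])).
  apply: fin_bigcap_measurable => // i _; apply: sub_sigma_algebra.
  by exists i, `[l 0 i, u 0 i]%classic; split.
apply/seteqP; split=> [x [lx xu] i _|x H]; first by rewrite /= in_itv/= lx xu.
by split=> i; have := H i I; rewrite /= in_itv/= => /andP[].
Qed.

Lemma measurable_gradient (Y : S -> 'rV[R]_n) (W : S -> Z) i :
  (forall i, measurable_fun [set: S] (fun s => Y s 0 i)) ->
  measurable_fun [set: S] W -> (forall s, X (Y s)) ->
  measurable_fun [set: S] (fun s => G (Y s) (W s) 0 i).
Proof.
move=> mY mW XY.
apply: (measurable_comp (F := [set p : borel_rV R n * Z | X p.1])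
  (f := fun p : borel_rV R n * Z => G p.1 p.2 0 i) (g := fun s => (Y s, W s))) => //.
- rewrite (_ : [set p | _] = (box l u : set (borel_rV R n)) `*` [set: Z]).
    by apply: measurableX => //; exact: measurable_box.
  by apply/seteqP; split=> -[a b] //= [].
- by move=> _ [s _ <-]; exact: XY.
- by apply/measurable_fun_pair => //; exact: measurable_rV.
Qed.

End VectorMeasurability.

Section MeanMeasurability.
Context {R : realType} {dS dZ : measure_display}.
Context {S : measurableType dS} {Z : measurableType dZ}.

(** The mean over a section is the difference of the integrals of the positive
    and negative parts, each measurable in [s] by Tonelli. *)
Lemma measurable_mean (P : probability Z R) (f : S * Z -> R) (m : S -> R) :
  measurable_fun [set: S * Z] f ->
  (forall s, (\int[P]_y (f (s, y))%:E = (m s)%:E)%E) -> measurable_fun [set: S] m.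
Proof.
move=> mf fm; apply/measurable_EFinP.
have mF : measurable_fun [set: S * Z] (EFin \o f) by exact/measurable_EFinP.
rewrite (_ : _ \o _ = (fun s => \int[P]_y (EFin \o f)^\+ (s, y)
    - \int[P]_y (EFin \o f)^\- (s, y))%E); last first.
  apply/funext => s /=; rewrite -fm integralE.
  by congr (_ - _)%E; apply: eq_integral => y _; rewrite ?funeposE ?funenegE.
apply: emeasurable_funB.
  apply: (@measurable_fun_fubini_tonelli_F _ _ S Z R P _ (measurable_funepos mF)) => //.
by apply: (@measurable_fun_fubini_tonelli_F _ _ S Z R P _ (measurable_funeneg mF)).
Qed.

End MeanMeasurability.

(** * Mean square error of the averaged gradients *)

Lemma integral_probability_cst {d} {T : measurableType d} {R : realType}
  (P : probability T R) (r : R) : (\int[P]_w r%:E = r%:E)%E.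
Proof. by have := expectation_cst P r; rewrite unlock. Qed.

Section NoisyGradient.
Context {R : realType} {n : nat} {dZ : measure_display} {Z : measurableType dZ}.
Variable P : probability Z R.
Implicit Types (a m : 'rV[R]_n).

(** Bias-variance decomposition: the cross term is a linear function of the
    centred vector [m - Y], so its mean is zero. *)
Lemma second_moment_shift (Y : Z -> 'rV[R]_n) a m (r s : R) :
  (forall i, P.-integrable setT (EFin \o (fun u => Y u 0 i))) ->
  (forall i, 'E_P[fun u => (Y u 0 i)%R] = (m 0 i)%:E)%E ->
  ('E_P[fun u => (enorm (Y u - m) ^+ 2)%R] <= s%:E)%E ->
  (\int[P]_u (enorm (a + r *: (m - Y u)) ^+ 2)%:E
     <= (enorm a ^+ 2 + r ^+ 2 * s)%:E)%E.
Proof.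
move=> iY EY; rewrite unlock => varY.
have mY i : measurable_fun setT (fun u => Y u 0 i).
  by apply/measurable_EFinP; exact: measurable_int (iY i).
have mN i : measurable_fun setT (fun u => (Y u - m) 0 i).
  under eq_fun do rewrite !mxE.
  by apply: measurable_funB.
pose Yc i u : R := Y u 0 i.
pose mc i : R := m 0 i.
pose N u := enorm (Y u - m) ^+ 2.
have iN : P.-integrable setT (EFin \o N).
  apply/integrableP; split; first exact/measurable_EFinP/measurable_sqr_enorm.
  under eq_integral => u _ do rewrite /= ger0_norm ?sqr_ge0//.
  exact: le_lt_trans varY (ltry _).
pose h i u := a 0 i * (m 0 i - Y u 0 i).
have ih1 i : P.-integrable setT (EFin \o (fun u => m 0 i - Y u 0 i)).
  rewrite (_ : _ \o _ = (EFin \o cst (mc i)) \- (EFin \o Yc i))%E; last first.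
    by apply/funext => u /=.
  by apply: integrableB => //; [exact: finite_measure_integrable_cst|exact: iY].
have ih i : P.-integrable setT (EFin \o h i).
  by apply: eq_integrable (integrableZl _ (a 0 i) (ih1 i)).
have Eh i : (\int[P]_u (h i u)%:E = 0)%E.
  under eq_integral do rewrite EFinM.
  rewrite integralZl//=; last exact: ih1.
  rewrite (_ : (fun _ => _) = (EFin \o cst (mc i)) \- (EFin \o Yc i))%E//.
  rewrite integralB//; [|exact: finite_measure_integrable_cst|exact: iY].
  have := EY i; rewrite unlock /= => ->.
  by rewrite integral_probability_cst subee// mule0.
have idot : P.-integrable setT (EFin \o (fun u => \sum_(i < n) h i u)).
  rewrite (_ : _ \o _ = (fun u => \sum_(i < n) (h i u)%:E)%E); last first.
    by apply/funext => u /=; rewrite sumEFin.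
  by apply: integrable_sum => // i _; exact: ih.
have Edot : (\int[P]_u (\sum_(i < n) h i u)%:E = 0)%E.
  under eq_integral do rewrite -sumEFin.
  by rewrite integral_sum// big1.
have E u : enorm (a + r *: (m - Y u)) ^+ 2 =
    enorm a ^+ 2 + (2 * r) * (\sum_(i < n) h i u) + r ^+ 2 * N u.
  have -> : \sum_(i < n) h i u = dotv a (m - Y u).
    by apply: eq_bigr => i _; rewrite !mxE.
  rewrite /N !sqr_enorm !dotvE !(dotvC (Y u)) (dotvC m a); ring.
under eq_integral do rewrite E !EFinD.
have ic : P.-integrable setT (fun=> (enorm a ^+ 2)%:E).
  exact: finite_measure_integrable_cst.
have id : P.-integrable setT (fun u => ((2 * r) * (\sum_(i < n) h i u))%:E).
  by apply: eq_integrable (integrableZl _ (2 * r) idot).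
have iv : P.-integrable setT (fun u => (r ^+ 2 * N u)%:E).
  by apply: eq_integrable (integrableZl _ (r ^+ 2) iN).
rewrite integralD//; last exact: integrableD.
rewrite integralD//= integral_probability_cst.
under [X in (_ + X + _)%E]eq_integral do rewrite EFinM.
rewrite integralZl// Edot mule0 adde0 EFinD leeD2l//.
under eq_integral do rewrite EFinM.
rewrite integralZl// [leRHS]EFinM.
by apply: lee_wpmul2l => //; rewrite lee_fin sqr_ge0.
Qed.

End NoisyGradient.

Section GradientEstimate.
Context {R : realType} {n : nat} {dO dZ : measure_display}.
Context {Omega : measurableType dO} {Z : measurableType dZ}.
Context {Pr : probability Omega R} {P : probability Z R}.
Variables (l u : 'rV[R]_n) (C : set 'rV[R]_n) (gradF : 'rV[R]_n -> 'rV[R]_n).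
Variables (G : 'rV[R]_n -> Z -> 'rV[R]_n) (T : nat) (rho : nat -> R).
Variables (z : nat -> {RV Pr >-> Z}) (x d v : nat -> Omega -> 'rV[R]_n).
Variables (D sigma L : R).
Let X := box l u.
Hypothesis CX : C `<=` X.
Hypothesis mG : forall i : 'I_n, measurable_fun [set p : borel_rV R n * Z | X p.1]
  (fun p => G p.1 p.2 0 i).
Hypothesis iidz : iid_samples P z.
Hypothesis run : nmscg C u G T rho z x d v.
Hypothesis Cx : forall t w, (t <= T)%N -> C (x t w).
Hypothesis normC : forall y, C y -> enorm y <= D.
Hypothesis meanG : forall y (i : 'I_n), C y ->
  P.-integrable setT (EFin \o (fun zz => G y zz 0 i)) /\
  ('E_P[fun zz => (G y zz 0 i)%R] = (gradF y 0 i)%:E)%E.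
Hypothesis varG : forall y, C y ->
  ('E_P[fun zz => (enorm (G y zz - gradF y) ^+ 2)%R] <= (sigma ^+ 2)%:E)%E.
Hypothesis L0 : 0 <= L.
Hypothesis lipF : elipschitz_on L X gradF.

Local Notation past t := (g_sigma_algebraType (sample_events z t)).

(** [x t] involves [v 0], ..., [v t.-1], hence the first [t.-1] samples only. *)
Lemma iterate_adapted t i : (t <= T)%N ->
  measurable_fun [set: past t.-1] (fun w => x t w 0 i).
Proof.
elim: t => [|t IH] tT.
  by under eq_fun do rewrite (nmscg_x0 run); exact: measurable_cst.
under eq_fun do rewrite (nmscg_xS run _ tT) !mxE.
apply: measurable_funD; first exact: past_widen (leq_pred t) (IH (ltnW tT)).
by apply: measurable_funM => //; exact: (nmscg_vmeas run).
Qed.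

Lemma estimate_adapted t i : (t < T)%N ->
  measurable_fun [set: past t] (fun w => d t w 0 i).
Proof.
elim: t i => [|t IH] i tT.
  by under eq_fun do rewrite (nmscg_d0 run); exact: measurable_cst.
under eq_fun => w do rewrite (nmscg_dS run w (t := t.+1) tT) !mxE.
apply: measurable_funD; apply: measurable_funM => //.
  exact: past_widen (leqnSn t) (IH i (ltnW tT)).
apply: (measurable_gradient (S := past t.+1) mG).
- by move=> j; apply: past_widen (iterate_adapted j (ltnW tT)).
- by apply: measurable_past_sample; rewrite leqnn.
- by move=> w; apply/CX/Cx/ltnW.
Qed.

(** [gradF] is the mean of the jointly measurable [G], so its measurability comes
    from Fubini. *)
Lemma gradient_adapted t i : (t <= T)%N ->
  measurable_fun [set: past t.-1] (fun w => gradF (x t w) 0 i).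
Proof.
move=> tT.
apply: (@measurable_mean R _ _ (past t.-1) Z P
  (fun p => G (x t p.1) p.2 0 i)).
  apply: (measurable_gradient (S := (past t.-1 * Z)%type) mG
    (Y := fun p => x t p.1) (W := snd)) => //.
  - move=> j; apply: (measurableT_comp (f := fun w : past t.-1 => x t w 0 j)) => //.
    exact: iterate_adapted.
  - by move=> p; exact/CX/Cx.
by move=> w; have [_] := meanG i (Cx w tT); rewrite unlock.
Qed.

Let err t w := enorm (gradF (x t w) - d t w) ^+ 2.

Lemma err_measurable t : (t < T)%N -> measurable_fun [set: Omega] (err t).
Proof.
move=> tT; apply: measurable_sqr_enorm => i; apply: (past_ambient (z := z) (t := t)).
under eq_fun do rewrite !mxE; apply: measurable_funB; last exact: estimate_adapted.
exact: past_widen (leq_pred t) (gradient_adapted i (ltnW tT)).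
Qed.

(** The new error is [U + r (gradF - G)], evaluated at [x t.+1], where
    [U = (1 - r) (gradF (x t.+1) - d t)] belongs to the past.  Freezing the past
    and [second_moment_shift] bound its mean square by that of [U] plus
    [r ^ 2 * sigma ^ 2].  The squared norm of [U] is split by [sqr_enormD_le]
    with weight [r / 2] into the old error and the drift of the gradient, which
    is at most [L D / T]. *)
Lemma err_step t : (t.+1 < T)%N -> 0 < rho t.+1 <= 1 ->
  let r := rho t.+1 in
  (\int[Pr]_w (err t.+1 w)%:E <=
    (1 - r / 2)%:E * \int[Pr]_w (err t w)%:E
    + (r ^+ 2 * sigma ^+ 2 + 2 * L ^+ 2 * D ^+ 2 / (r * T%:R ^+ 2))%:E)%E.
Proof.
move=> tT r01 /=; set r := rho t.+1 in r01 *; have /andP[r0 r1] := r01.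
have T0 : 0 < T%:R :> R by rewrite ltr0n (leq_trans _ tT).
have Ti : 0 < T%:R^-1 :> R by rewrite invr_gt0.
pose U w := (1 - r) *: (gradF (x t.+1 w) - d t w).
pose f (p : past t * Z) := (enorm (U p.1 + r *: (gradF (x t.+1 p.1) - G (x t.+1 p.1) p.2)) ^+ 2)%:E.
have mx j : measurable_fun [set: past t] (fun w => x t.+1 w 0 j).
  exact: (iterate_adapted j (ltnW tT)).
have mg j : measurable_fun [set: past t] (fun w => gradF (x t.+1 w) 0 j).
  exact: (gradient_adapted j (ltnW tT)).
have mU j : measurable_fun [set: past t] (fun w => U w 0 j).
  under eq_fun do rewrite !mxE; apply: measurable_funM => //; apply: measurable_funB => //.
  exact: estimate_adapted (ltnW tT).
have pull (h : past t -> R) : measurable_fun [set: past t] h ->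
    measurable_fun [set: past t * Z] (fun p => h p.1).
  by move=> mh; exact: (measurableT_comp mh).
have mf : measurable_fun [set: past t * Z] f.
  apply/measurable_EFinP.
  apply: (@measurable_sqr_enorm R n _ (past t * Z)%type) => j.
  rewrite (_ : (fun _ => _) = (fun p : past t * Z => U p.1 0 j
      + r * (gradF (x t.+1 p.1) 0 j - G (x t.+1 p.1) p.2 0 j))); last first.
    by apply/funext => p; rewrite !mxE.
  apply: measurable_funD; first exact: pull (mU j).
  apply: measurable_funM => //; apply: measurable_funB; first exact: pull (mg j).
  apply: (measurable_gradient (S := (past t * Z)%type) mG
    (Y := fun p => x t.+1 p.1) (W := snd)) => //.
  - by move=> k; exact: pull (mx k).
  - by move=> p; exact/CX/Cx/ltnW.
have Eerr w : (err t.+1 w)%:E = f (w, z t.+1 w).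
  rewrite /f /err /U (nmscg_dS run w (t := t.+1) tT) /= -/r; congr (enorm _ ^+ 2)%:E.
  by apply/rowP => j; rewrite !mxE; ring.
under eq_integral do rewrite Eerr.
rewrite (freeze_past iidz mf); last by move=> p; rewrite lee_fin sqr_ge0.
have Uerr w : enorm (U w) ^+ 2 + r ^+ 2 * sigma ^+ 2 <=
   (1 - r / 2) * err t w + (r ^+ 2 * sigma ^+ 2 + 2 * L ^+ 2 * D ^+ 2 / (r * T%:R ^+ 2)).
  have drift : enorm (gradF (x t.+1 w) - gradF (x t w)) <= L * D / T%:R.
    have tT' := ltnW tT.
    apply: le_trans (lipF (CX (Cx w tT')) (CX (Cx w (ltnW tT')))) _.
    rewrite (nmscg_xS run w tT') [x t w + _]addrC addrK enormZ ger0_norm ?(ltW Ti)//.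
    rewrite -mulrA ler_wpM2l// mulrC ler_wpM2r ?(ltW Ti)//.
    by apply: normC; have [[]] := nmscg_v run w tT'.
  have r20 : 0 < r / 2 by lra.
  have := sqr_enormD_le (gradF (x t w) - d t w) (gradF (x t.+1 w) - gradF (x t w)) r20.
  rewrite [X in enorm X](_ : _ = gradF (x t.+1 w) - d t w); last first.
    by rewrite addrC addrA subrK.
  rewrite enormZ exprMn real_normK ?num_real// -/(err t w).
  have {drift} := ler_sqr_enorm drift.
  rewrite expr_div_n exprMn; set b := enorm _ ^+ 2; set a := enorm _ ^+ 2 => dr yg.
  have e0 : 0 <= err t w by exact: sqr_ge0.
  have b0 : 0 <= b by exact: sqr_ge0.
  have k1 : (1 - r) ^+ 2 * (1 + r / 2) <= 1 - r / 2 by nra.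
  have k2 : (1 - r) ^+ 2 * (1 + (r / 2)^-1) <= 2 / r.
    rewrite -subr_ge0 (_ : _ - _ = r^-1 * (3 * r - r ^+ 3)); last by field; rewrite gt_eqF.
    by rewrite mulr_ge0 ?invr_ge0 ?ltW//; nra.
  have h1 := ler_wpM2l (sqr_ge0 (1 - r)) yg.
  have h2 := ler_wpM2r e0 k1.
  have h3 := ler_wpM2r b0 k2.
  have h4 : 2 / r * b <= 2 * L ^+ 2 * D ^+ 2 / (r * T%:R ^+ 2).
    rewrite (_ : 2 * L ^+ 2 * D ^+ 2 / _ = 2 / r * (L ^+ 2 * D ^+ 2 / T%:R ^+ 2)).
      by rewrite ler_wpM2l// divr_ge0 ?ltW.
    by field; rewrite !gt_eqF.
  move: h1 h2 h3 h4; rewrite mulrDr !mulrA; lra.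
pose c := r ^+ 2 * sigma ^+ 2 + 2 * L ^+ 2 * D ^+ 2 / (r * T%:R ^+ 2).
have c0 : 0 <= c.
  apply: addr_ge0; first exact: mulr_ge0 (sqr_ge0 _) (sqr_ge0 _).
  apply: divr_ge0; last exact: mulr_ge0 (ltW r0) (sqr_ge0 _).
  exact: mulr_ge0 (mulr_ge0 (ler0n _ 2) (sqr_ge0 _)) (sqr_ge0 _).
have r2 : 0 <= 1 - r / 2 by lra.
have err0 w : 0 <= err t w by exact: sqr_ge0.
apply: (@le_trans _ _ (\int[Pr]_w ((1 - r / 2) * err t w + c)%:E)%E).
  apply: ge0_le_integral => //.
  - by move=> w _; apply: integral_ge0 => s _; rewrite lee_fin sqr_ge0.
  - have f0 p : (0 <= f p)%E by rewrite lee_fin sqr_ge0.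
    have mF := @measurable_fun_fubini_tonelli_F _ _ (past t) Z R P _ mf f0.
    move=> _ B mB; apply: (sub_past (z := z) (t := t)).
    exact: mF measurableT B mB.
  - apply/measurable_EFinP; apply: measurable_funD => //.
    by apply: measurable_funM => //; exact: err_measurable (ltnW tT).
  - move=> w _; apply: (@le_trans _ _ (enorm (U w) ^+ 2 + r ^+ 2 * sigma ^+ 2)%:E); last first.
      rewrite lee_fin; exact: Uerr.
    have Cw := Cx w (ltnW tT).
    apply: (@second_moment_shift R n dZ Z P (G (x t.+1 w)) (U w) (gradF (x t.+1 w))).
    - by move=> i; have [] := meanG i Cw.
    - by move=> i; have [] := meanG i Cw.
    - exact: varG.
under eq_integral do rewrite EFinD EFinM.
have merr : measurable_fun [set: Omega] (fun w => (err t w)%:E).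
  by apply/measurable_EFinP; exact: err_measurable (ltnW tT).
have err0E w : [set: Omega] w -> (0 <= (err t w)%:E)%E by rewrite lee_fin.
rewrite ge0_integralD//=; last 2 first.
- by move=> w _; rewrite mule_ge0 ?lee_fin.
- exact: measurable_funeM.
rewrite ge0_integralZl_EFin//.
by rewrite integral_probability_cst.
Qed.

(** [contraction_step] closes the induction once the driving terms of [err_step]
    add up to at most [Q / c ^ 4]; this uses [T >= 8] for the drift. *)
Lemma err_bound (Q : R) : (8 <= T)%N ->
  (forall t, rho t = 4 / cbrt (t%:R + 8) ^+ 2) ->
  4 * enorm (gradF 0) ^+ 2 <= Q ->
  16 * sigma ^+ 2 + 2 * L ^+ 2 * D ^+ 2 <= Q ->
  forall t, (t < T)%N ->
  (\int[Pr]_w (err t w)%:E <= (Q / cbrt (t%:R + 8) ^+ 2)%:E)%E.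
Proof.
move=> T8 rhoE Qg Qs; elim=> [|t IH] tT.
  rewrite cbrt_shift0.
  under eq_integral do rewrite /err (nmscg_x0 run) (nmscg_d0 run) subr0.
  rewrite integral_probability_cst.
  by rewrite lee_fin; lra.
have Q0 : 0 <= Q by apply: le_trans Qg; rewrite mulr_ge0 ?sqr_ge0.
have T0 : 0 < T%:R :> R by rewrite ltr0n (leq_trans _ T8).
have [c2 cS e3] := @cbrt_shift R t.
have := contraction_step t Q0; move: c2 cS e3 (IH (ltnW tT)) (rhoE t.+1) (@cbrtK R (t.+1%:R + 8)).
set a := cbrt (t%:R + 8); set b := cbrt (t.+1%:R + 8) => a2 ab e3 {}IH rE bK contr.
have b4 : 4 <= b ^+ 2 by nra.
have b0 : 0 < b by lra.
have r01 : 0 < rho t.+1 <= 1.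
  by rewrite rE divr_gt0 ?ler_pdivrMr ?mul1r//; lra.
apply: le_trans (err_step tT r01) _; rewrite {}rE.
have -> : 1 - 4 / b ^+ 2 / 2 = 1 - 2 / b ^+ 2 by field; rewrite gt_eqF.
have k0 : 0 <= 1 - 2 / b ^+ 2 by rewrite subr_ge0 ler_pdivrMr; lra.
apply: (@le_trans _ _ ((1 - 2 / b ^+ 2) * (Q / a ^+ 2) + Q / b ^+ 4)%:E); last by rewrite lee_fin.
rewrite [leRHS]EFinD [X in (_ <= X + _)%E]EFinM; apply: leeD.
  by apply: lee_wpmul2l => //; rewrite lee_fin.
rewrite lee_fin.
(* [b ^+ 3 = t.+1 + 8] is at most [2 T], which turns the drift into a multiple of [b ^- 4]. *)
have b3 : b ^+ 3 <= 2 * T%:R.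
  rewrite bK ?addr_ge0// -!natrD -natrM ler_nat.
  by rewrite mul2n -addnn (leq_add (ltnW tT)).
have b6 : b ^+ 6 <= 4 * T%:R ^+ 2.
  have b30 : 0 <= b ^+ 3 by rewrite exprn_ge0// ltW.
  by rewrite (exprM _ 3 2); nra.
have LD0 : 0 <= L ^+ 2 * D ^+ 2 by exact: mulr_ge0 (sqr_ge0 _) (sqr_ge0 _).
have -> : (4 / b ^+ 2) ^+ 2 * sigma ^+ 2 + 2 * L ^+ 2 * D ^+ 2 / (4 / b ^+ 2 * T%:R ^+ 2) =
   (16 * sigma ^+ 2 + L ^+ 2 * D ^+ 2 * (b ^+ 6 / (2 * T%:R ^+ 2))) / b ^+ 4.
  by field; rewrite !gt_eqF.
rewrite ler_wpM2r ?invr_ge0 ?exprn_ge0 ?(ltW b0)//; apply: le_trans Qs.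
rewrite lerD2l (_ : 2 * L ^+ 2 * D ^+ 2 = L ^+ 2 * D ^+ 2 * 2); last by ring.
rewrite ler_wpM2l//.
by rewrite ler_pdivrMr; [lra|rewrite mulr_gt0 ?exprn_gt0].
Qed.

End GradientEstimate.

(** * Convergence rate *)

Section Expectation.
Context {R : realType} {dO : measure_display} {Omega : measurableType dO}.
Variable Pr : probability Omega R.

(** For nonnegative functions the integral is a supremum over simple minorants,
    and a minorant of [f] is one of [g]. *)
Lemma le_integral_nonmeasurable (f g : Omega -> \bar R) :
  (forall w, 0 <= f w)%E -> (forall w, f w <= g w)%E ->
  (\int[Pr]_w f w <= \int[Pr]_w g w)%E.
Proof.
move=> f0 fg; rewrite !ge0_integralTE//; last by move=> w; exact: le_trans (fg w).
apply: ereal_sup_le => _ [h hf <-]; exists h => // w.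
exact: le_trans (hf w) (fg w).
Qed.

(** Integrate the measurable minorant [max 0 (M - S)] of [Y]: together with [S] it
    is at least [max 0 M]. *)
Lemma expectation_ge_sub (Y S : Omega -> R) (M B : R) :
  (forall w, 0 <= Y w) -> measurable_fun setT S -> (forall w, 0 <= S w) ->
  (forall w, M <= Y w + S w) -> (\int[Pr]_w (S w)%:E <= B%:E)%E ->
  ((M - B)%:E <= 'E_Pr[Y])%E.
Proof.
move=> Y0 mS S0 MYS SB; rewrite unlock.
pose g w := Num.max 0 (M - S w).
have mg : measurable_fun setT g.
  by apply: measurable_maxr => //; exact: measurable_funB.
have g0 w : 0 <= g w by rewrite le_max lexx.
apply: (@le_trans _ _ (\int[Pr]_w (g w)%:E)%E); last first.
  apply: le_integral_nonmeasurable => w; rewrite lee_fin//.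
  by rewrite ge_max Y0/= lerBlDr.
rewrite EFinB leeBlDr//; apply: (@le_trans _ _ (\int[Pr]_w (g w)%:E + \int[Pr]_w (S w)%:E)%E).
  rewrite -ge0_integralD//; [|by move=> w _; rewrite lee_fin|exact/measurable_EFinP|
    by move=> w _; rewrite lee_fin|exact/measurable_EFinP].
  rewrite -[leLHS](integral_probability_cst Pr).
  apply: (@le_trans _ _ (\int[Pr]_w (Num.max 0 M)%:E)%E).
    by rewrite !integral_probability_cst lee_fin le_max lexx orbT.
  apply: le_integral_nonmeasurable => w; first by rewrite lee_fin le_max lexx.
  rewrite -EFinD lee_fin ge_max addr_ge0//=.
  by rewrite -lerBlDr le_max lexx orbT.
exact: leeD2l.
Qed.

Lemma integral_affine_sum_le T (a b q : 'I_T -> R) (f : 'I_T -> Omega -> R) :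
  (forall t, 0 <= a t) -> (forall t, 0 <= b t) ->
  (forall t, measurable_fun setT (f t)) -> (forall t w, 0 <= f t w) ->
  (forall t, (\int[Pr]_w (f t w)%:E <= (q t)%:E)%E) ->
  (\int[Pr]_w (\sum_(t < T) (a t * f t w + b t))%:E
     <= (\sum_(t < T) (a t * q t + b t))%:E)%E.
Proof.
move=> a0 b0 mf f0 fq.
under eq_integral do rewrite -sumEFin.
have m t : measurable_fun setT (fun w => (a t * f t w + b t)%:E).
  apply/measurable_EFinP; apply: measurable_funD => //.
  exact: measurable_funM.
rewrite ge0_integral_sum//; last first.
  by move=> t w _; rewrite lee_fin addr_ge0// mulr_ge0.
rewrite -sumEFin; apply: lee_sum => t _.
under eq_integral do rewrite EFinD EFinM.
have mft : measurable_fun setT (fun w => (f t w)%:E) by exact/measurable_EFinP.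
have ft0 w : [set: Omega] w -> (0 <= (f t w)%:E)%E by rewrite lee_fin.
rewrite ge0_integralD//=; last 3 first.
- by move=> w _; rewrite mule_ge0 ?lee_fin.
- exact: measurable_funeM.
- by move=> w _; rewrite lee_fin.
rewrite ge0_integralZl_EFin//.
rewrite integral_probability_cst.
by rewrite EFinD EFinM leeD2r// lee_wpmul2l ?lee_fin.
Qed.

End Expectation.

Theorem theorem8 (R : realType) (n : nat)
    (dO dZ : measure_display)
    (Omega : measurableType dO) (Z : measurableType dZ)
    (Pr : probability Omega R) (P : probability Z R)
    (l ubar : 'rV[R]_n) (C : set 'rV[R]_n)
    (F : 'rV[R]_n -> R) (gradF : 'rV[R]_n -> 'rV[R]_n)
    (Ft : 'rV[R]_n -> Z -> R) (gradFt : 'rV[R]_n -> Z -> 'rV[R]_n)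
    (T : nat) (z : nat -> {RV Pr >-> Z})
    (x d v : nat -> Omega -> 'rV[R]_n)
    (xstar : 'rV[R]_n) (D sigma L : R) :
  let X := box l ubar in
  let rho := fun t : nat => 4 / (t%:R + 8) `^ (2 / 3) : R in
  (* recall that x_0 = d_0 = 0 *)
  let Q := Num.max (4 * enorm (gradF 0) ^+ 2)
                   (16 * sigma ^+ 2 + 2 * L ^+ 2 * D ^+ 2) in
  (* the box and the constraint set *)
  vle 0 l ->
  C `<=` X -> compact C -> convex_set (C : set (convex_lmodType 'rV[R]_n)) ->
  C 0 ->
  (* the stochastic function and its gradient *)
  (forall y zz, X y -> is_gradient_within X (Ft^~ zz) y (gradFt y zz)) ->
  (forall i : 'I_n, measurable_fun [set p : borel_rV R n * Z | X p.1]
     (fun p => gradFt p.1 p.2 0 i)) ->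
  (* the objective *)
  (forall y, X y -> P.-integrable setT (EFin \o Ft y) /\
                    ('E_P[Ft y] = (F y)%:E)%E) ->
  (forall y, X y -> is_gradient_within X F y (gradF y)) ->
  (forall y, X y -> 0 <= F y) ->
  dr_submodular X F gradF ->
  (* the iterates *)
  (0 < T)%N ->
  iid_samples P z ->
  nmscg C ubar gradFt T rho z x d v ->
  (* assumptions (1)-(4) *)
  (forall y, C y -> enorm y <= D) ->
  (forall y (i : 'I_n), C y ->
     P.-integrable setT (EFin \o (fun zz => gradFt y zz 0 i)) /\
     ('E_P[fun zz => (gradFt y zz 0 i)%R] = (gradF y 0 i)%:E)%E) ->
  (forall y, C y ->
     ('E_P[fun zz => (enorm (gradFt y zz - gradF y) ^+ 2)%R]
        <= (sigma ^+ 2)%:E)%E) ->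
  elipschitz_on L X gradF ->
  down_closed C ->
  argmax F C xstar ->
  ((expR (- 1) * F xstar - 15 * D * Num.sqrt Q / T%:R `^ (1 / 3)
      - L * D ^+ 2 / (2 * T%:R))%:E
   <= 'E_Pr[fun w => F (x T w)])%E.
Proof.
move=> X rho Q l_ge0 CX _ convexC C0 _ mG _ dF F0 [_ antiF] T0 iidz run normC
  meanG varG lipF downC [Cxs _].
have l0 : l = 0.
  apply/rowP => i; apply: le_anti; have := l_ge0 i; rewrite !mxE => ->.
  by rewrite andbT; have [/(_ i)] := CX _ C0; rewrite mxE.
rewrite {}/X {}l0 {l_ge0} in CX mG dF F0 antiF lipF *.
have convC y1 y2 a : C y1 -> C y2 -> 0 <= a <= 1 -> C (a *: y1 + (1 - a) *: y2).
  move=> Cy1 Cy2 /andP[a0 a1].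
  by have := convexC y1 y2 (Itv01 a0 a1) (mem_set Cy1) (mem_set Cy2); rewrite inE.
have lipA : elipschitz_on `|L| (box 0 ubar) gradF.
  move=> y1 y2 Xy1 Xy2; apply: le_trans (lipF _ _ Xy1 Xy2) _.
  by rewrite ler_wpM2r ?enorm_ge0 ?ler_norm.
have L0 : 0 <= `|L| by [].
have Cx t w : (t <= T)%N -> C (x t w).
  apply: (iterate_feasible CX convC C0 downC T0 (x := x^~ w) (v := v^~ w)
    (nmscg_x0 run w)) => s sT; [exact: (nmscg_v run)|exact: (nmscg_xS run)].
have D0 : 0 <= D by apply: le_trans (normC _ C0); exact: enorm_ge0.
have TR : 1 <= T%:R :> R by rewrite ler1n.
have Qg : 4 * enorm (gradF 0) ^+ 2 <= Q by rewrite le_max lexx.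
have Qs : 16 * sigma ^+ 2 + 2 * L ^+ 2 * D ^+ 2 <= Q by rewrite le_max lexx orbT.
have Q0 : 0 <= Q by apply: le_trans Qg; rewrite mulr_ge0 ?sqr_ge0.
set s := Num.sqrt Q; have s0 : 0 <= s := sqrtr_ge0 _.
have sQ : s ^+ 2 = Q by rewrite sqr_sqrtr.
have g0 := enorm_ge0 (gradF 0).
have gs : 2 * enorm (gradF 0) <= s.
  rewrite -(ler_pXn2r (n := 2)) ?nnegrE ?mulr_ge0// exprMn sQ.
  by rewrite (_ : 2 ^+ 2 = 4)//; ring.
have Ls : `|L| * D <= s.
  rewrite -(ler_pXn2r (n := 2)) ?nnegrE ?mulr_ge0// exprMn sQ real_normK ?num_real//.
  have := sqr_ge0 sigma; have : 0 <= L ^+ 2 * D ^+ 2 by rewrite -exprMn sqr_ge0.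
  by move: Qs; lra.
have LD2 : `|L| * D ^+ 2 <= D * s by rewrite expr2 mulrCA ler_wpM2l.
have Labs : - (`|L| * D ^+ 2) <= L * D ^+ 2.
  by rewrite -mulNr ler_wpM2r ?sqr_ge0// lerNnormlW.
set tau := T%:R `^ (1 / 3).
have tau3 : tau ^+ 3 = T%:R by rewrite -[tau]/(cbrt T%:R) cbrtK.
have tau1 : 1 <= tau.
  by rewrite -(ler_pXn2r (n := 3)) ?nnegrE ?powR_ge0// tau3 expr1n.
have tau0 : 0 < tau by lra.
have tauT : tau <= T%:R by rewrite -tau3; nra.
set N := T%:R in TR tau3 tauT *.
have N0 : 0 < N by lra.
have Ds0 : 0 <= D * s by rewrite mulr_ge0.
(* The averaged estimate is used only for [8 <= T] and a positive [Q]. *)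
have [hard|easy] := boolP ((8 <= T)%N && (0 < s)); last first.
  have FT w : expR (- 1) * F xstar - 2 * enorm (gradF 0) * D - `|L| * D ^+ 2 / 2
      <= F (x T w).
    exact: (rough_bound CX C0 normC dF antiF F0 L0 lipA Cxs (Cx T w (leqnn T))).
  rewrite -[X in X%:E]subr0.
  apply: (expectation_ge_sub (S := cst 0)) => //.
  - by move=> w; apply/F0/CX/Cx.
  - move=> w; rewrite /= addr0; apply: le_trans (FT w).
    have gD : 2 * enorm (gradF 0) * D <= D * s by rewrite [D * s]mulrC ler_wpM2r.
    have small : 2 * (D * s) <= 15 * D * s / tau.
      rewrite ler_pdivlMr//.
      have [->|sn0] := eqVneq s 0; first by rewrite !mulr0 mul0r.
      have T8 : (T < 8)%N.
        by move: easy; rewrite negb_and -ltnNge lt0r sn0 s0 orbF.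
      have tau2 : tau <= 2.
        rewrite -(ler_pXn2r (n := 3)) ?nnegrE ?(ltW tau0)// tau3.
        by rewrite (_ : 2 ^+ 3 = 8%:R) ?ler_nat ?(ltnW T8)//; ring.
      nra.
    have : - (`|L| * D ^+ 2 / 2) <= L * D ^+ 2 / (2 * N).
      have i0 : 0 <= (2 * N)^-1 by rewrite invr_ge0; lra.
      have i2 : (2 * N)^-1 <= 2^-1 by rewrite lef_pV2 ?posrE; lra.
      have k0 : 0 <= `|L| * D ^+ 2 by rewrite mulr_ge0 ?sqr_ge0.
      by have := ler_wpM2r i0 Labs; have := ler_wpM2l k0 i2; lra.
    lra.
  - by rewrite integral_probability_cst.
have /andP[T8 s1] := hard.
pose c t : R := cbrt (t%:R + 8).
have c2 t : 2 <= c t by have [] := @cbrt_shift R t.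
have cp t : 0 < c t by have := c2 t; lra.
have rhoE t : rho t = 4 / c t ^+ 2 by rewrite /rho powR23.
have Qs' : 16 * sigma ^+ 2 + 2 * `|L| ^+ 2 * D ^+ 2 <= Q by rewrite real_normK ?num_real.
pose err t w := enorm (gradF (x t w) - d t w) ^+ 2.
have errQ t : (t < T)%N -> (\int[Pr]_w (err t w)%:E <= (Q / c t ^+ 2)%:E)%E.
  exact: (err_bound CX mG iidz run Cx normC meanG varG L0 lipA T8 rhoE Qg Qs').
have merr t : (t < T)%N -> measurable_fun setT (err t).
  exact: (err_measurable CX mG run Cx meanG).
(* Weights of [2 y <= y ^ 2 / lam + lam] with [lam = s / c t], the bound on the
   root mean square error at index [t]. *)
pose a t := N^-1 * D * (c t / s).
pose b t := N^-1 * D * (s / c t).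
pose S w := \sum_(t < T) (a t * err t w + b t).
have a0 t : 0 <= a t by rewrite /a !mulr_ge0 ?invr_ge0 ?(ltW N0) ?(ltW (cp t)).
have b0 t : 0 <= b t by rewrite /b !mulr_ge0 ?invr_ge0 ?(ltW N0) ?(ltW (cp t)).
have err0 t w : 0 <= err t w by exact: sqr_ge0.
pose M := expR (- 1) * F xstar - `|L| * D ^+ 2 / (2 * N).
apply: (@le_trans _ _ (M - 9 * D * s / tau)%:E).
  rewrite lee_fin /M.
  have h1 : `|L| * D ^+ 2 / (2 * N) - L * D ^+ 2 / (2 * N) <= D * s / tau.
    rewrite -mulrBl invfM mulrA.
    apply: le_trans (_ : D * s / N <= _); last first.
      by rewrite ler_wpM2l// lef_pV2.
    by rewrite ler_wpM2r ?invr_ge0 ?(ltW N0)//; lra.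
  have h2 : 0 <= D * s / tau by rewrite divr_ge0 ?(ltW tau0).
  rewrite -!mulrA in h1 h2 *; lra.
apply: (expectation_ge_sub (S := S)).
- by move=> w; apply/F0/CX/Cx.
- apply: measurable_sum => t; apply: measurable_funD => //.
  by apply: measurable_funM => //; exact: merr.
- by move=> w; apply: sumr_ge0 => t _; rewrite addr_ge0// mulr_ge0.
- move=> w; rewrite -lerBlDr.
  have pb := path_bound CX convC C0 downC normC dF antiF F0 L0 lipA Cxs T0
    (x := x^~ w) (d := d^~ w) (v := v^~ w) (nmscg_x0 run w)
    (fun t tT => nmscg_v run w tT) (fun t tT => nmscg_xS run w tT).
  apply: le_trans pb; rewrite lerB// mulr_sumr; apply: ler_sum => t _.
  rewrite /a /b /err; set y := enorm _; rewrite -/N.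
  have ND : 0 <= N^-1 * D by rewrite mulr_ge0 ?invr_ge0 ?(ltW N0).
  rewrite -!(mulrA (N^-1 * D)) -mulrDr (_ : N^-1 * _ = N^-1 * D * (2 * y)); last by ring.
  rewrite ler_wpM2l// -subr_ge0.
  rewrite (_ : _ - _ = c t / s * (y - s / c t) ^+ 2); last by field; rewrite !gt_eqF.
  by rewrite mulr_ge0 ?sqr_ge0 ?divr_ge0 ?(ltW (cp t)).
- apply: le_trans (integral_affine_sum_le (q := fun t => Q / c t ^+ 2)
    (f := fun t => err t) _ _ _ _ _) _ => //.
  + by move=> t; exact: merr.
  + by move=> t; exact: errQ.
  rewrite lee_fin.
  under eq_bigr => t _.
    rewrite (_ : _ + _ = 2 * N^-1 * (D * s) * (c t)^-1); last first.
      by rewrite /a /b -sQ; field; rewrite !gt_eqF.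
    over.
  rewrite -mulr_sumr.
  (* [T + 8 <= 2 T <= (3 / 2) ^ 3 * T]. *)
  have cT : c T <= 3 / 2 * tau.
    rewrite -(ler_pXn2r (n := 3)) ?nnegrE ?mulr_ge0 ?(ltW tau0) ?(ltW (cp T))//.
    rewrite exprMn tau3 cbrtK ?addr_ge0//.
    have : 8 <= N by rewrite ler_nat.
    rewrite -/N (_ : (3 / 2) ^+ 3 = 27 / 8); [lra|by field].
  have sumc := @sum_inv_cbrt R T.
  have sumc' : \sum_(t < T) (c t)^-1 <= 9 / 2 * tau ^+ 2.
    apply: le_trans sumc _; have := cp T; rewrite -/(c T); nra.
  rewrite (_ : 9 * D * s / tau = 2 * N^-1 * (D * s) * (9 / 2 * tau ^+ 2)).
    by rewrite ler_wpM2l// !mulr_ge0 ?invr_ge0 ?(ltW N0).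
  by rewrite -tau3; field; rewrite gt_eqF.
Qed.
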